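(* Let $n\in\mathbb{N}$, $m\in\{0,\ldots,n-1\}$, and let $\mu$ be a self-similar measure on a self-similar set $E\subset\mathbb{R}^n$ satisfying the open set condition. If $\mu$ is purely $m$-unrectifiable and $0<\alpha\le 1$, then there is $1<s=s(\mu,n,m,\alpha)<\infty$ so that $$\liminf_{r\downarrow 0}\ \inf_{\theta\in S^{n-1},\,V\in G(n,n-m)}\frac{\mu\bigl(B(x,r)\cap X(x,V,\alpha)\setminus H(x,\theta,\alpha)\bigr)}{|\log r|^{-s}\,\mu\bigl(B(x,r)\bigr)}\ge 1$$ for $\mu$-almost all $x\in\mathbb{R}^n$.
   Context: Self-similar sets and measures: let $\kappa\ge 2$ and for each $i\in\{1,\ldots,\kappa\}$ let $f_i\colon\mathbb{R}^n\to\mathbb{R}^n$ and $0<r_i<1$ satisfy $|f_i(x)-f_i(y)|=r_i|x-y|$ for all $x,y\in\mathbb{R}^n$. The self-similar set $E$ is the unique nonempty compact set with $E=\bigcup_{i=1}^\kappa f_i(E)$. The open set condition is satisfied if there is a nonempty open set $U$ with $\bigcup_{i=1}^\kappa f_i(U)\subset U$, the union being pairwise disjoint. Let $\Sigma=\{1,\ldots,\kappa\}^{\mathbb{N}}$ and let $\pi\colon\Sigma\to E$ be the natural projection, $\{\pi(i_1i_2\cdots)\}=\bigcap_{k}f_{i_1}\circ\cdots\circ f_{i_k}(E)$. Given a probability vector $(p_1,\ldots,p_\kappa)$, the Bernoulli measure $\nu$ on $\Sigma$ is determined by giving each cylinder $[i_1\cdots i_k]$ (all sequences beginning with $i_1\cdots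 i_k$) the measure $p_{i_1}\cdots p_{i_k}$; the self-similar measure on $E$ is the image $\mu=\pi\nu$ of $\nu$ under $\pi$. Notation: $B(x,r)$ is the closed ball with centre $x$ and radius $r>0$, $S^{n-1}$ the unit sphere of $\mathbb{R}^n$, $G(n,n-m)$ the space of all $(n-m)$-dimensional linear subspaces of $\mathbb{R}^n$. For $0\le\alpha\le 1$, $X(x,V,\alpha)=\{y\in\mathbb{R}^n:\operatorname{dist}(y-x,V)<\alpha|y-x|\}$ and $H(x,\theta,\alpha)=\{y\in\mathbb{R}^n:(y-x)\cdot\theta>\alpha|y-x|\}$. A set $A\subset\mathbb{R}^n$ is $m$-rectifiable if there are Lipschitz maps $g_i\colon\mathbb{R}^m\to\mathbb{R}^n$, $i\in\mathbb{N}$, such that $\mathcal{H}^m\bigl(A\setminus\bigcup_i g_i(\mathbb{R}^m)\bigr)=0$, where $\mathcal{H}^m$ is the $m$-dimensional Hausdorff measure. A measure $\mu$ is purely $m$-unrectifiable if $\mu(A)=0$ for all $m$-rectifiable sets $A\subset\mathbb{R}^n$. *)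

(* Defs.v *)
From HB Require Import structures.
From mathcomp Require Export all_boot all_order all_algebra.
From mathcomp Require Export all_classical all_reals all_analysis.

Set Implicit Arguments.
Unset Strict Implicit.
Unset Printing Implicit Defensive.

Import Order.TTheory GRing.Theory Num.Theory.
Import numFieldNormedType.Exports.

Local Open Scope classical_set_scope.
Local Open Scope ring_scope.

(* R^n is 'rV[R]_n. The library norm on 'rV[R]_n is the sup norm, so the
   Euclidean structure is defined here; both induce the library topology. *)
Section Euclidean.
Context {R : realType} {n : nat}.
Implicit Types (x y theta : 'rV[R]_n) (V : {vspace 'rV[R]_n}) (alpha r : R).

Definition dot x y : R := \sum_(i < n) x ord0 i * y ord0 i.

Definition enorm x : R := Num.sqrt (dot x x).

Definition edist x V : R := inf [set enorm (x - v) | v in [set v | v \in V]].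

Definition closed_eball x r : set 'rV[R]_n := [set y | enorm (y - x) <= r].

Definition unit_sphere : set 'rV[R]_n := [set theta | enorm theta = 1].

Definition grassmannian (k : nat) : set {vspace 'rV[R]_n} :=
  [set V | \dim V = k].

Definition coneX x V alpha : set 'rV[R]_n :=
  [set y | edist (y - x) V < alpha * enorm (y - x)].

Definition coneH x theta alpha : set 'rV[R]_n :=
  [set y | dot (y - x) theta > alpha * enorm (y - x)].

End Euclidean.

Section Rectifiability.
Context {R : realType} {n : nat}.
Implicit Type A : set 'rV[R]_n.

(* equal to -oo on the empty set *)
Definition ediam A : \bar R :=
  ereal_sup [set (enorm (x - y))%:E | x in A & y in A].

(* diam(A)^m, with 0^0 = 1 for a nonempty A of diameter 0 and with value 0 on
   the empty set, so that the case m = 0 gives the counting measure; no normalising constant,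
   as only null sets matter *)
Definition hausdorff_gauge (m : nat) A : \bar R :=
  if A == set0 then 0%E else (ediam A ^+ m)%E.

Definition hausdorff_content (m : nat) (delta : R) A : \bar R :=
  ereal_inf [set (\sum_(0 <= i <oo) hausdorff_gauge m (C i))%E | C in
    [set C : (set 'rV[R]_n)^nat | A `<=` \bigcup_i C i /\
                                  forall i, (ediam (C i) <= delta%:E)%E]].

Definition hausdorff_measure (m : nat) A : \bar R :=
  ereal_sup [set hausdorff_content m delta A | delta in [set d : R | 0 < d]].

Definition elipschitz (m : nat) (g : 'rV[R]_m -> 'rV[R]_n) : Prop :=
  exists L : R, forall x y, enorm (g x - g y) <= L * enorm (x - y).

Definition rectifiable (m : nat) A : Prop :=
  exists g : nat -> 'rV[R]_m -> 'rV[R]_n, (forall i, elipschitz (g i)) /\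
    hausdorff_measure m (A `\` \bigcup_i range (g i)) = 0%E.

End Rectifiability.

(* R^n with its Borel sigma-algebra *)
Definition borelRn (R : realType) (n : nat) :=
  g_sigma_algebraType (@open 'rV[R]_n).

(* A need not be Borel: negligibility says that the outer measure induced by
   mu vanishes at A *)
Definition purely_unrectifiable (R : realType) (n m : nat)
    (mu : {measure set borelRn R n -> \bar R}) : Prop :=
  forall A : set 'rV[R]_n, rectifiable m A -> mu.-negligible A.

(* Alphabets have N.+1 letters: the library requires the carrier of a
   sigma-algebra to be pointed, which rules out the empty alphabet. *)
HB.instance Definition _ (N : nat) := isPointed.Build 'I_N.+1 ord0.

Definition cylinder (N : nat) (u : seq 'I_N.+1) : set (nat -> 'I_N.+1) :=
  [set w | mkseq w (size u) = u].

Definition code_space (N : nat) := g_sigma_algebraType (range (@cylinder N)).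

Section SelfSimilar.
Context {R : realType} {n N : nat}.
Implicit Types (f : 'I_N.+1 -> 'rV[R]_n -> 'rV[R]_n) (p : 'I_N.+1 -> R).
Implicit Type E : set 'rV[R]_n.

Definition contracting_similitudes (r : 'I_N.+1 -> R) f : Prop :=
  forall i, 0 < r i < 1 /\
            forall x y, enorm (f i x - f i y) = r i * enorm (x - y).

Definition self_similar_set f E : Prop :=
  [/\ E !=set0, compact E & E = \bigcup_i (f i @` E)].

Definition open_set_condition f : Prop :=
  exists U : set 'rV[R]_n,
    [/\ U !=set0, open U, \bigcup_i (f i @` U) `<=` U &
        trivIset setT (fun i => f i @` U)].

Definition word_map f (u : seq 'I_N.+1) : 'rV[R]_n -> 'rV[R]_n :=
  foldr (fun i g => f i \o g) id u.

(* the element of the singleton \bigcap_k f_(w 0) o ... o f_(w (k-1)) (E) *)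
Definition natural_projection f E (w : nat -> 'I_N.+1) : 'rV[R]_n :=
  xget 0 (\bigcap_k (word_map f (mkseq w k) @` E)).

Definition probability_vector p : Prop :=
  (forall i, 0 <= p i) /\ \sum_i p i = 1.

Definition bernoulli_measure p (nu : {measure set code_space N -> \bar R}) :=
  forall u, nu (cylinder u) = (\prod_(i <- u) p i)%:E.

Definition self_similar_measure f E p
    (mu : {measure set borelRn R n -> \bar R}) : Prop :=
  exists nu : {measure set code_space N -> \bar R}, bernoulli_measure p nu /\
    forall A : set (borelRn R n), measurable A ->
      mu A = pushforward nu
               (natural_projection f E : code_space N -> borelRn R n) A.

End SelfSimilar.

Definition cone_ratio (R : realType) (n : nat)
    (mu : {measure set borelRn R n -> \bar R}) (alpha s : R) (x : 'rV[R]_n)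
    (r : R) (theta : 'rV[R]_n) (V : {vspace 'rV[R]_n}) : \bar R :=
  (mu ((closed_eball x r `&` coneX x V alpha) `\` coneH x theta alpha)
   / ((`|ln r| `^ (- s))%:E * mu (closed_eball x r)))%E.

(* Main.v *)
From HB Require Import structures.
Require Import Defs.
From mathcomp Require Import ring lra zify measurable_realfun.

(** The measure [mu] of a small ball around a typical point [x] is compared with
the measure of the image of [E] under a word: if [x] has code [w], and [k] is the
first level at which the image of [E] under the prefix of length [k] of [w] has
diameter at most [r], then this image is contained in the ball of radius [r], and
by the open set condition it is unlikely that its mass is smaller than that of
the ball by more than a power of [k]. Indeed the balls of radius comparable to
their images around the images of the words of length [k] overlap at most
polynomially often in [k]: words with the same letter counts have the same
contraction ratio, hence at most boundedly many of them meet a ball of that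
size, and the number of letter counts is polynomial ([overlap_card],
[nu_light_word]).

The geometric input is that for every [V] there are two points of [E], with codes
of positive weight, whose difference lies in the cone of opening [alpha] around
[V]. Otherwise the orthogonal projection along [V] would be injective on a set of
full measure, with Lipschitz inverse, and this set would be covered by a
Lipschitz image of [R^m] ([rectifiable_lip_graph],
[flat_pairs_of_unrectifiable]). Since the cone around [V] is symmetric, exchanging
the two points also gets rid of the cone in direction [theta]. These conditions
are open, so they persist on the images of [E] under two words. By compactness
of the set of pairs [(V, theta)], here in the form of orthonormal frames whose
entries are rounded, finitely many pairs of words are enough; as a word map
rotates the cones, concatenation gives one universal word [u]: whatever [V] and
[theta], every point of the image of [E] under [u] sees in its cone the image of
[E] under some word from a finite list ([universal_word]).

Finally a typical code contains [u] within the [C * log k] letters that follow its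
[k]-th letter, for all large [k], by the Borel-Cantelli lemma
([ae_typical_codes]). Prescribing these letters costs only a power of [k], and [k]
is at most a constant times [|log r|], which is where the power of [|log r|]
comes from ([cone_mass]). The almost sure statement on codes is carried to [R^n]
by Koenig's lemma, which supplies a Borel exceptional set ([ae_codes]). *)

Set Implicit Arguments.
Unset Strict Implicit.
Unset Printing Implicit Defensive.

Import Order.TTheory GRing.Theory Num.Theory.
Import numFieldNormedType.Exports.

Local Open Scope classical_set_scope.
Local Open Scope ring_scope.

(** * Euclidean geometry of row vectors *)

Section EuclideanTheory.
Context {R : realType}.

Lemma dot_mulmx n (x y : 'rV[R]_n) : dot x y = (x *m y^T) ord0 ord0.
Proof. by rewrite mxE; apply: eq_bigr => i _; rewrite mxE. Qed.

Lemma dotC n (x y : 'rV[R]_n) : dot x y = dot y x.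
Proof. by apply: eq_bigr => i _; rewrite mulrC. Qed.

Lemma dotDl n (x y z : 'rV[R]_n) : dot (x + y) z = dot x z + dot y z.
Proof. by rewrite !dot_mulmx mulmxDl mxE. Qed.

Lemma dotNl n (x z : 'rV[R]_n) : dot (- x) z = - dot x z.
Proof. by rewrite !dot_mulmx mulNmx mxE. Qed.

Lemma dotZl n a (x z : 'rV[R]_n) : dot (a *: x) z = a * dot x z.
Proof. by rewrite !dot_mulmx -scalemxAl mxE. Qed.

Lemma dot0l n (z : 'rV[R]_n) : dot 0 z = 0.
Proof. by rewrite dot_mulmx mul0mx mxE. Qed.

Lemma dotDr n (x y z : 'rV[R]_n) : dot z (x + y) = dot z x + dot z y.
Proof. by rewrite !(dotC z) dotDl. Qed.

Lemma dotNr n (x z : 'rV[R]_n) : dot z (- x) = - dot z x.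
Proof. by rewrite !(dotC z) dotNl. Qed.

Lemma dotZr n a (x z : 'rV[R]_n) : dot z (a *: x) = a * dot z x.
Proof. by rewrite !(dotC z) dotZl. Qed.

Lemma dot_mulmxl n p (x : 'rV[R]_n) (M : 'M[R]_(n, p)) (y : 'rV[R]_p) :
  dot (x *m M) y = dot x (y *m M^T).
Proof. by rewrite !dot_mulmx trmx_mul trmxK mulmxA. Qed.

Lemma dot_ge0 n (x : 'rV[R]_n) : 0 <= dot x x.
Proof. by apply: sumr_ge0 => i _; rewrite -expr2 sqr_ge0. Qed.

Lemma enorm_ge0 n (x : 'rV[R]_n) : 0 <= enorm x.
Proof. exact: sqrtr_ge0. Qed.

Lemma enorm_sq n (x : 'rV[R]_n) : enorm x ^+ 2 = dot x x.
Proof. by rewrite sqr_sqrtr // dot_ge0. Qed.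

Lemma ler_enorm_dot n p (x : 'rV[R]_n) (y : 'rV[R]_p) :
  (enorm x <= enorm y) = (dot x x <= dot y y).
Proof. by rewrite ler_sqrt ?dot_ge0. Qed.

Lemma enorm0 n : enorm (0 : 'rV[R]_n) = 0.
Proof.
by rewrite /enorm /dot big1 ?sqrtr0 // => i _; rewrite mxE mul0r.
Qed.

Lemma abs_coord_le_enorm n (x : 'rV[R]_n) i : `|x ord0 i| <= enorm x.
Proof.
rewrite -(ler_pXn2r (n := 2)) ?nnegrE ?enorm_ge0 // enorm_sq real_normK ?num_real //.
rewrite /dot (bigD1 i) //= -expr2 lerDl.
by apply: sumr_ge0 => j _; rewrite -expr2 sqr_ge0.
Qed.

Lemma enorm_eq0 n (x : 'rV[R]_n) : (enorm x == 0) = (x == 0).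
Proof.
apply/eqP/eqP => [h|->]; last exact: enorm0.
apply/rowP => i; rewrite mxE; apply/eqP; rewrite -normr_le0 -h.
exact: abs_coord_le_enorm.
Qed.

Lemma enorm_gt0 n (x : 'rV[R]_n) : (0 < enorm x) = (x != 0).
Proof. by rewrite lt_def enorm_eq0 enorm_ge0 andbT. Qed.

Lemma enormZ n a (x : 'rV[R]_n) : enorm (a *: x) = `|a| * enorm x.
Proof.
by rewrite /enorm dotZl dotZr mulrA -expr2 sqrtrM ?sqr_ge0 // sqrtr_sqr.
Qed.

Lemma enormN n (x : 'rV[R]_n) : enorm (- x) = enorm x.
Proof. by rewrite -scaleN1r enormZ normrN1 mul1r. Qed.

Lemma enormB n (x y : 'rV[R]_n) : enorm (x - y) = enorm (y - x).
Proof. by rewrite -enormN opprB. Qed.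

Lemma cauchy_schwarz n (x y : 'rV[R]_n) : `|dot x y| <= enorm x * enorm y.
Proof.
rewrite -(ler_pXn2r (n := 2)) ?nnegrE ?mulr_ge0 ?enorm_ge0 //.
rewrite exprMn !enorm_sq real_normK ?num_real //.
have [->|x0] := eqVneq x 0.
  by rewrite !dot0l mul0r expr0n.
have dx0 : 0 < dot x x by rewrite -enorm_sq exprn_gt0 // enorm_gt0.
have := dot_ge0 (dot x x *: y - dot x y *: x).
rewrite dotDl dotNl !dotDr !dotNr !dotZl !dotZr (dotC y x) => h.
rewrite -(ler_pM2l dx0); nra.
Qed.

Lemma ler_enormD n (x y : 'rV[R]_n) : enorm (x + y) <= enorm x + enorm y.
Proof.
rewrite -(ler_pXn2r (n := 2)) ?nnegrE ?addr_ge0 ?enorm_ge0 //.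
rewrite sqrrD !enorm_sq dotDl !dotDr (dotC y x).
have := le_trans (ler_norm _) (cauchy_schwarz x y); lra.
Qed.

Lemma ler_enorm_dist n (z x y : 'rV[R]_n) :
  enorm (x - y) <= enorm (x - z) + enorm (z - y).
Proof. by apply: le_trans (ler_enormD _ _); rewrite addrA subrK. Qed.

Lemma ler_enormB_dist n (x y : 'rV[R]_n) : `|enorm x - enorm y| <= enorm (x - y).
Proof.
rewrite ler_norml; apply/andP; split.
- by have := ler_enormD (y - x) x; rewrite subrK (enormB y x); lra.
- by have := ler_enormD (x - y) y; rewrite subrK; lra.
Qed.

Lemma enorm_le_sum n (x : 'rV[R]_n) : enorm x <= \sum_i `|x ord0 i|.
Proof.
have s0 : 0 <= \sum_i `|x ord0 i| by apply: sumr_ge0 => i _.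
rewrite -(ler_pXn2r (n := 2)) ?nnegrE ?enorm_ge0 // enorm_sq expr2 mulr_suml.
apply: ler_sum => i _; rewrite -expr2 -(real_normK (num_real (x _ _))) expr2.
apply: ler_wpM2l => //; rewrite (bigD1 i) //= lerDl.
by apply: sumr_ge0 => j _.
Qed.

Lemma enorm_mulmx_le n p (x : 'rV[R]_n) (M : 'M[R]_(n, p)) :
  enorm (x *m M) <= (\sum_j \sum_i `|M i j|) * enorm x.
Proof.
apply: (le_trans (enorm_le_sum _)); rewrite mulr_suml; apply: ler_sum => j _.
rewrite mxE mulr_suml; apply: (le_trans (ler_norm_sum _ _ _)).
apply: ler_sum => i _; rewrite normrM mulrC; apply: ler_wpM2l => //.
exact: abs_coord_le_enorm.
Qed.

Lemma norm_le_enorm n (x : 'rV[R]_n) : `|x| <= enorm x.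
Proof.
rewrite /Num.Def.normr /= mx_normrE; apply: bigmax_le => [|[i j] _]; first exact: enorm_ge0.
by rewrite (ord1 i) abs_coord_le_enorm.
Qed.

Lemma coord_le_norm n (x : 'rV[R]_n) i : `|x ord0 i| <= `|x|.
Proof.
rewrite [leRHS]/Num.Def.normr /= mx_normrE.
by apply: (le_bigmax _ (fun ij : 'I_1 * 'I_n => `|x ij.1 ij.2|) (ord0, i)).
Qed.

Lemma enorm_le_norm n (x : 'rV[R]_n) : enorm x <= n%:R * `|x|.
Proof.
apply: (le_trans (enorm_le_sum _)).
have -> : n%:R * `|x| = \sum_(i < n) `|x|.
  by rewrite sumr_const card_ord mulr_natl.
by apply: ler_sum => i _; exact: coord_le_norm.
Qed.

Lemma dot_le_norm n (x y : 'rV[R]_n) : dot x y <= enorm x * enorm y.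
Proof. exact: le_trans (ler_norm _) (cauchy_schwarz _ _). Qed.

(** The two norms being comparable, a function that is Lipschitz for the
Euclidean distance is continuous for the product topology. *)
Lemma lip_continuous n (h : 'rV[R]_n -> R) (L : R) :
  (forall x y, `|h x - h y| <= L * enorm (x - y)) -> continuous h.
Proof.
move=> hL x.
have Fx : Filter (nbhs x) := nbhs_filter x.
apply/(@cvgrPdist_lt _ _ _ (nbhs x)) => e e0.
have K0 : 0 < (`|L| + 1) * (n%:R + 1) :> R.
  by rewrite mulr_gt0 // ltr_wpDl.
near=> y.
apply: (le_lt_trans (hL _ _)).
apply: (@le_lt_trans _ _ ((`|L| + 1) * (n%:R + 1) * `|x - y|)).
  apply: (@le_trans _ _ ((`|L| + 1) * (n%:R * `|x - y|))).
    apply: (@le_trans _ _ ((`|L| + 1) * enorm (x - y))).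
      by rewrite ler_wpM2r ?enorm_ge0 // (le_trans (ler_norm _)) // lerDl.
    by rewrite ler_wpM2l ?enorm_le_norm // addr_ge0.
  by rewrite -mulrA ler_wpM2l ?addr_ge0 // ler_wpM2r // lerDl.
rewrite mulrC -ltr_pdivlMr //.
near: y; apply: cvgr_dist_lt => //; exact: divr_gt0.
Unshelve. all: by end_near. Qed.

Lemma enorm_continuous n (a : 'rV[R]_n) : continuous (fun y : 'rV[R]_n => enorm (y - a)).
Proof.
apply: (@lip_continuous _ _ 1) => x y; rewrite mul1r.
by apply: (le_trans (ler_enormB_dist _ _)); rewrite opprB addrA subrK.
Qed.

Lemma scale_enorm_continuous n c (a : 'rV[R]_n) :
  continuous (fun y : 'rV[R]_n => c * enorm (y - a)).
Proof.
apply: (@lip_continuous _ _ `|c|) => x y; rewrite -mulrBr normrM ler_wpM2l //.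
by apply: (le_trans (ler_enormB_dist _ _)); rewrite opprB addrA subrK.
Qed.

Lemma edist_has_inf n (x : 'rV[R]_n) (V : {vspace 'rV[R]_n}) :
  has_inf [set enorm (x - v) | v in [set v | v \in V]].
Proof.
split; first by exists (enorm (x - 0)), 0 => //=; rewrite mem0v.
by exists 0 => _ [v _ <-]; exact: enorm_ge0.
Qed.

Lemma edist_le n (x v : 'rV[R]_n) (V : {vspace 'rV[R]_n}) :
  v \in V -> edist x V <= enorm (x - v).
Proof. by move=> vV; apply: (ge_inf (edist_has_inf x V).2); exists v. Qed.

Lemma edist_lip n (V : {vspace 'rV[R]_n}) (x y : 'rV[R]_n) :
  edist x V - edist y V <= enorm (x - y).
Proof.
rewrite lerBlDl -lerBlDr.
apply: (lb_le_inf (edist_has_inf y V).1) => _ [v /= vV <-].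
rewrite lerBlDr; apply: (le_trans (edist_le x vV)).
by rewrite [leRHS]addrC; exact: ler_enorm_dist.
Qed.

Lemma edist_continuous n (a : 'rV[R]_n) (V : {vspace 'rV[R]_n}) :
  continuous (fun y : 'rV[R]_n => edist (y - a) V).
Proof.
apply: (@lip_continuous _ _ 1) => x y; rewrite mul1r.
have xy : x - a - (y - a) = x - y by rewrite opprB addrA subrK.
rewrite ler_norml; apply/andP; split.
- by have := edist_lip V (y - a) (x - a); rewrite enormB xy; lra.
- by have := edist_lip V (x - a) (y - a); rewrite xy; lra.
Qed.

Lemma closed_eball_closed n (x : 'rV[R]_n) r : closed (closed_eball x r).
Proof.
apply: (closed_comp (f := fun y : 'rV[R]_n => enorm (y - x))) (@closed_le _ r) => y _.
exact: enorm_continuous.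
Qed.

Lemma open_lt_set n (h1 h2 : 'rV[R]_n -> R) :
  continuous h1 -> continuous h2 -> open [set y | h1 y < h2 y].
Proof.
move=> c1 c2.
have -> : [set y | h1 y < h2 y] = (fun y => h2 y - h1 y) @^-1` [set t | 0 < t].
  by apply/seteqP; split => y /=; rewrite subr_gt0.
apply: open_comp; last exact: open_gt.
by move=> y _; exact: (cvgB (c2 y) (c1 y)).
Qed.

Lemma coneX_open n (x : 'rV[R]_n) V alpha : open (coneX x V alpha).
Proof.
exact: (open_lt_set (@edist_continuous n x V) (@scale_enorm_continuous n alpha x)).
Qed.

Lemma coneH_open n (x theta : 'rV[R]_n) alpha : open (coneH x theta alpha).
Proof.
apply: (open_lt_set (@scale_enorm_continuous n alpha x)).
apply: (@lip_continuous _ (fun y : 'rV[R]_n => dot (y - x) theta) (enorm theta)) => u v.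
rewrite -dotNl -dotDl opprB addrA subrK mulrC; exact: cauchy_schwarz.
Qed.

End EuclideanTheory.

(** * Similitudes and orthonormal frames *)

Section LinearAlgebra.
Context {R : realType}.

(** A map of a Euclidean space that multiplies distances by a constant
preserves, once normalised and translated, the inner product by polarisation;
its values on the canonical basis then determine it linearly. *)
Lemma similitude_affine n (g : 'rV[R]_n -> 'rV[R]_n) (rho : R) : 0 < rho ->
  (forall x y, enorm (g x - g y) = rho * enorm (x - y)) ->
  exists O : 'M[R]_n, exists b : 'rV[R]_n,
    O *m O^T = 1%:M /\ forall x, g x = rho *: (x *m O) + b.
Proof.
move=> rho0 hg; pose h x := rho^-1 *: (g x - g 0).
have hB x y : enorm (h x - h y) = enorm (x - y).
  rewrite /h -scalerBr opprB addrA subrK enormZ hg mulrA ger0_norm ?invr_ge0 ?ltW //.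
  by rewrite mulVf ?gt_eqF // mul1r.
have h0 : h 0 = 0 by rewrite /h subrr scaler0.
have hn x : dot (h x) (h x) = dot x x.
  by rewrite -!enorm_sq -[h x]subr0 -{1}h0 hB subr0.
have hd x y : dot (h x) (h y) = dot x y.
  have := congr1 (fun t => t ^+ 2) (hB x y); rewrite !enorm_sq.
  rewrite !dotDl !dotDr !dotNl !dotNr !hn (dotC (h y) (h x)) (dotC y x); lra.
have dx x i : dot x (delta_mx 0 i) = x 0 i.
  rewrite /dot (bigD1 i) //= mxE !eqxx mulr1 big1 ?addr0 // => j ji.
  by rewrite mxE (negbTE ji) andbF mulr0.
pose O := \matrix_i h (delta_mx 0 i) : 'M[R]_n.
have hO x : h x *m O^T = x.
  apply/rowP => i; rewrite -[RHS]dx -hd dot_mulmx !mxE.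
  by apply: eq_bigr => j _; rewrite !mxE.
have OO : O *m O^T = 1%:M.
  by apply/row_matrixP => i; rewrite row_mul rowK hO rowE mulmx1.
exists O, (g 0); split => // x.
have -> : x *m O = h x by rewrite -{1}(hO x) -mulmxA (mulmx1C OO) mulmx1.
by rewrite /h scalerA mulfV ?gt_eqF // scale1r subrK.
Qed.

Lemma enorm_orthomx n (O : 'M[R]_n) x : O *m O^T = 1%:M -> enorm (x *m O) = enorm x.
Proof. by move=> OO; rewrite /enorm dot_mulmxl -mulmxA OO mulmx1. Qed.

(** A frame with fewer than [n - \dim V] vectors can be enlarged: the equations
saying that [z] is orthogonal to it and to [V] have a nonzero solution. *)
Lemma orthonormal_frame n (V : {vspace 'rV[R]_n}) m : (m + \dim V <= n)%N ->
  exists M : 'M[R]_(n, m), M^T *m M = 1%:M /\ forall v, v \in V -> v *m M = 0.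
Proof.
elim: m => [_|m IH mV].
  by exists 0; split => [|v _]; [apply/matrixP => -[] | apply/matrixP => ? []].
have [M [MM MV]] := IH (ltnW mV).
pose B := \matrix_(i < n, j < \dim V) ((vbasis V)`_j) 0 i.
have /rowV0Pn[z /sub_kermxP zK z0] : kermx (row_mx B M) != 0.
  rewrite -mxrank_eq0 mxrank_ker -lt0n subn_gt0.
  by apply: leq_ltn_trans (rank_leq_col _) _; rewrite addnC.
move: zK; rewrite mul_mx_row -[0]row_mx0 => /eq_row_mx[zB zM].
have zV v : v \in V -> dot v z = 0.
  move=> /coord_vbasis ->; rewrite dot_mulmx mulmx_suml summxE big1 // => j _.
  rewrite -scalemxAl mxE -dot_mulmx.
  suff -> : dot ((vbasis V)`_j) z = 0 by rewrite mulr0.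
  move/rowP/(_ j): zB; rewrite !mxE => <-.
  by apply: eq_bigr => i _; rewrite !mxE mulrC.
pose e := (enorm z)^-1 *: z.
have ez : enorm z != 0 by rewrite enorm_eq0.
pose M' : 'M[R]_(n, 1 + m) := row_mx e^T M.
have MM' : M'^T *m M' = 1%:M.
  rewrite tr_row_mx mul_col_row trmxK MM [RHS]scalar_mx_block; congr block_mx.
  - apply/matrixP => i j; rewrite !ord1 -dot_mulmx mxE eqxx /e dotZl dotZr -enorm_sq.
    by rewrite mulrA expr2 mulrACA mulVf // mulr1.
  - by rewrite /e -scalemxAl zM scaler0.
  - by rewrite -[M^T *m e^T]trmx_mul /e -scalemxAl zM scaler0 trmx0.
have MV' v : v \in V -> v *m M' = 0.
  move=> vV; rewrite mul_mx_row MV // -[RHS]row_mx0; congr row_mx.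
  apply/rowP => i; rewrite (ord1 i) -dot_mulmx /e dotZr zV // mulr0.
  by rewrite mxE.
by exists M'.
Qed.

(** Subtracting from [z] its projection on an orthonormal frame of [V^\perp]
leaves a vector orthogonal to the frame, hence, by a dimension count, in [V];
so the coordinates of [z] in the frame control its distance to [V]. *)
Lemma edist_frame n m (V : {vspace 'rV[R]_n}) : (m <= n)%N -> \dim V = (n - m)%N ->
  exists M : 'M[R]_(n, m), (forall z, enorm (z *m M) <= enorm z) /\
    (forall z, edist z V <= enorm (z *m M)).
Proof.
move=> mn dV; have [|M [MM MV]] := @orthonormal_frame n V m.
  by rewrite dV subnKC.
have proj z : enorm (z *m M *m M^T) = enorm (z *m M).
  by rewrite /enorm dot_mulmxl trmxK -mulmxA MM mulmx1.
exists M; split => z.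
  rewrite ler_enorm_dot; set P := z *m M *m M^T.
  have PP : dot P P = dot (z *m M) (z *m M) by rewrite -!enorm_sq proj.
  have zP : dot z P = dot (z *m M) (z *m M) by rewrite [RHS]dot_mulmxl.
  have := dot_ge0 (z - P); rewrite dotDl !dotDr !dotNl !dotNr (dotC P z) PP zP; lra.
pose phi := linfun (mulmxr M) : 'Hom('rV[R]_n, 'rV[R]_m).
have phiE x : phi x = x *m M by rewrite lfunE.
have VE : V = lker phi.
  apply/eqP; rewrite eqEdim; apply/andP; split.
    by apply/subvP => v vV; rewrite memv_ker phiE MV.
  have := limg_ker_dim phi fullv; rewrite capfv.
  have -> : (phi @: fullv)%VS = fullv.
    apply/vspaceP => y; rewrite memvf; apply/memv_imgP; exists (y *m M^T).
      by rewrite memvf.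
    by rewrite phiE -mulmxA MM mulmx1.
  rewrite !dimvf /dim /= dV !mul1n => h.
  by rewrite leq_subRL // addnC; apply: eq_leq.
have zV : z - z *m M *m M^T \in V.
  by rewrite VE memv_ker phiE mulmxBl -(mulmxA (z *m M)) MM mulmx1 subrr.
by apply: le_trans (edist_le z zV) _; rewrite opprB addrCA subrr addr0 proj.
Qed.

Lemma enorm_delta_mx n (i : 'I_n) : enorm (delta_mx 0 i : 'rV[R]_n) = 1.
Proof.
rewrite /enorm /dot (bigD1 i) //= mxE !eqxx mulr1 big1 ?addr0 ?sqrtr1 // => j ji.
by rewrite mxE (negbTE ji) andbF mulr0.
Qed.

Lemma entry_le1_contraction n m (M : 'M[R]_(n, m)) i j :
  (forall z, enorm (z *m M) <= enorm z) -> `|M i j| <= 1.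
Proof.
move=> /(_ (delta_mx 0 i)); rewrite enorm_delta_mx -rowE.
by apply: le_trans; have := abs_coord_le_enorm (row i M) j; rewrite mxE.
Qed.

(** Total boundedness of the matrices with entries in [[-1, 1]], by rounding. *)
Lemma bounded_matrix_net a b (eta : R) : 0 < eta ->
  exists s : seq 'M[R]_(a, b), forall M : 'M[R]_(a, b),
    (forall i j, `|M i j| <= 1) ->
    exists2 M', M' \in s & forall i j, `|M i j - M' i j| <= eta.
Proof.
move=> eta0; pose K := (Num.truncn eta^-1).+1.
have K0 : 0 < K%:R :> R by rewrite ltr0n.
have Keta : K%:R^-1 <= eta.
  rewrite -[leRHS]invrK lef_pV2 ?posrE ?invr_gt0 // ltW //.
  by have /andP[_] := truncn_itv (ltW (etrans (invr_gt0 eta) eta0)).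
pose val (q : 'I_(2 * K).+1) : R := q%:R / K%:R - 1.
exists [seq map_mx val Q | Q : 'M['I_(2 * K).+1]_(a, b)] => M M1.
pose Q := \matrix_(i < a, j < b) (inord (Num.truncn ((M i j + 1) * K%:R)) : 'I_(2 * K).+1).
exists (map_mx val Q); first by apply: map_f; rewrite mem_enum.
move=> i j; rewrite !mxE /val.
have := M1 i j; rewrite ler_norml => /andP[Ml Mr].
have p0 : 0 <= (M i j + 1) * K%:R by apply: mulr_ge0; [lra|exact: ltW].
have /andP[t1 t2] := truncn_itv p0.
rewrite inordK; last first.
  rewrite ltnS -(ler_nat R); apply: (le_trans t1); rewrite natrM.
  by apply: ler_wpM2r; [exact: ltW|lra].
move: t1 t2; set t := (Num.truncn _) => t1 t2.
rewrite opprB addrA -(ler_pM2r K0) -[X in _ * X <= _](gtr0_norm K0) -normrM.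
have -> : (M i j + 1 - t%:R / K%:R) * K%:R = (M i j + 1) * K%:R - t%:R.
  by rewrite mulrBl divfK ?gt_eqF.
apply: (@le_trans _ _ 1); last by rewrite -ler_pdivrMr // div1r.
rewrite ler_norml; move: t2; rewrite -natr1; lra.
Qed.

End LinearAlgebra.

(** * Lipschitz graphs are rectifiable *)

Section Rectifiable.
Context {R : realType}.

Lemma ediam_ge0 n (A : set 'rV[R]_n) : A !=set0 -> (0 <= ediam A)%E.
Proof.
move=> [x Ax]; apply: ereal_sup_ubound; exists x => //; exists x => //.
by rewrite subrr enorm0.
Qed.

Lemma hausdorff_gauge_ge0 n m (A : set 'rV[R]_n) : (0 <= hausdorff_gauge m A)%E.
Proof.
rewrite /hausdorff_gauge; case: ifPn => // /set0P A0.
by apply: expe_ge0; exact: ediam_ge0.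
Qed.

Lemma hausdorff_measure0 n m : hausdorff_measure m (set0 : set 'rV[R]_n) = 0%E.
Proof.
have H0 (d : R) : 0 < d -> hausdorff_content m d (set0 : set 'rV[R]_n) = 0%E.
  move=> d0; apply/eqP; rewrite eq_le; apply/andP; split; last first.
    apply: le_ereal_inf_tmp => _ [C _ <-].
    by apply: nneseries_ge0 => i _ _; exact: hausdorff_gauge_ge0.
  apply: ereal_inf_lbound; exists (fun=> set0).
    split=> // _; rewrite /ediam (_ : [set _ | _ in _ & _ in _] = set0) ?ereal_sup0 ?leNye //.
    by apply/seteqP; split => // t [].
  by rewrite eseries0 // => i _ _; rewrite /hausdorff_gauge eqxx.
apply/eqP; rewrite eq_le; apply/andP; split.
  by apply: ge_ereal_sup => _ [d /= d0 <-]; rewrite H0.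
by apply: ereal_sup_ubound; exists 1 => /=; rewrite ?H0.
Qed.

(** On [A] the map [x |-> x *m M] has a Lipschitz inverse; McShane's formula
extends each coordinate of this inverse to the whole of [R^m], and a single
Lipschitz image then covers [A]. *)
Lemma rectifiable_lip_graph n m (A : set 'rV[R]_n) (M : 'M[R]_(n, m)) (c : R) :
  0 < c -> (forall x y, A x -> A y -> c * enorm (x - y) <= enorm ((x - y) *m M)) ->
  rectifiable m A.
Proof.
move=> c0 hA.
have [-> | /set0P[a0 Aa0]] := eqVneq A set0.
  exists (fun _ _ => 0); split; last by rewrite set0D hausdorff_measure0.
  by move=> _; exists 0 => x y; rewrite subrr enorm0 mul0r.
pose S z j := [set (a ord0 j + c^-1 * enorm (z - a *m M)) | a in A].
pose g z : 'rV[R]_n := \row_j inf (S z j).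
have ic0 : 0 < c^-1 by rewrite invr_gt0.
have near a b j : A a -> A b -> b ord0 j <= a ord0 j + c^-1 * enorm (b *m M - a *m M).
  move=> Aa Ab; rewrite -mulmxBl -lerBlDl.
  apply: (@le_trans _ _ (enorm (b - a))).
    by have := abs_coord_le_enorm (b - a) j; rewrite !mxE; apply: le_trans; exact: ler_norm.
  by rewrite mulrC ler_pdivlMr // mulrC hA.
have lip0 z z' (a : 'rV[R]_n) : c^-1 * enorm (z - a *m M) <=
    c^-1 * enorm (z' - a *m M) + c^-1 * enorm (z - z').
  rewrite -mulrDr ler_pM2l // [leRHS]addrC; exact: ler_enorm_dist.
have infS z j : has_inf (S z j).
  split; first by exists (a0 ord0 j + c^-1 * enorm (z - a0 *m M)), a0.
  exists (a0 ord0 j - c^-1 * enorm (a0 *m M - z)) => _ [a Aa <-].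
  by have := near _ _ j Aa Aa0; have := lip0 (a0 *m M) z a; lra.
have lip z z' j : inf (S z j) - inf (S z' j) <= c^-1 * enorm (z - z').
  rewrite lerBlDl -lerBlDr; apply: (lb_le_inf (infS _ _).1) => _ [a Aa <-].
  rewrite lerBlDr; apply: (@le_trans _ _ (a ord0 j + c^-1 * enorm (z - a *m M))).
    by apply: (ge_inf (infS _ _).2); exists a.
  by rewrite -addrA lerD2l lip0.
exists (fun=> g); split.
  move=> _; exists (n%:R * c^-1) => z z'.
  apply: (le_trans (enorm_le_sum _)).
  have -> : n%:R * c^-1 * enorm (z - z') = \sum_(i < n) c^-1 * enorm (z - z').
    by rewrite sumr_const card_ord -mulrA mulr_natl.
  apply: ler_sum => j _; rewrite !mxE ler_norml lip andbT.
  by have := lip z' z j; rewrite enormB; lra.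
rewrite (_ : _ `\` _ = set0) ?hausdorff_measure0 // setD_eq0 => x Ax.
exists 0%N => //; exists (x *m M) => //; apply/rowP => j; rewrite mxE.
apply/eqP; rewrite eq_le; apply/andP; split.
  by apply: (ge_inf (infS _ _).2); exists x => //; rewrite subrr enorm0 mulr0 addr0.
by apply: (lb_le_inf (infS _ _).1) => _ [a Aa <-]; exact: near.
Qed.

End Rectifiable.

(** * Words and codes *)

Section Words.
Context {R : realType}.

Lemma exists_minorant N (q : 'I_N.+1 -> R) : exists i, forall j, q i <= q j.
Proof.
have [i _ hi] := @Order.TotalTheory.arg_minP _ R 'I_N.+1 ord0 xpredT q isT.
by exists i => j; exact: hi.
Qed.

Lemma geometric_small (a b e : R) : 0 <= a < 1 -> 0 < e -> exists k, b * a ^+ k <= e.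
Proof.
move=> /andP[a0 a1] e0.
have cv : b * a ^+ k @[k --> \oo] --> b * 0.
  by apply: cvgMr; apply: cvg_expr; rewrite ger0_norm.
rewrite mulr0 in cv.
have [k _ hk] := cvgr0_norm_le _ cv e e0.
exists k; apply: le_trans (ler_norm _) _; exact: (hk k (leqnn k)).
Qed.

Definition wprod N (q : 'I_N.+1 -> R) (u : seq 'I_N.+1) : R := \prod_(i <- u) q i.

Lemma wprod_nil N (q : 'I_N.+1 -> R) : wprod q [::] = 1.
Proof. exact: big_nil. Qed.

Lemma wprod_cat N (q : 'I_N.+1 -> R) u v : wprod q (u ++ v) = wprod q u * wprod q v.
Proof. exact: big_cat. Qed.

Lemma wprod_ge0 N (q : 'I_N.+1 -> R) u : (forall i, 0 <= q i) -> 0 <= wprod q u.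
Proof. by move=> q0; apply: prodr_ge0 => i _. Qed.

Lemma wprod_gt0 N (q : 'I_N.+1 -> R) u : all (fun i => 0 < q i) u -> 0 < wprod q u.
Proof.
elim: u => [|i u IH] /=; first by rewrite wprod_nil.
by move=> /andP[i0 /IH]; rewrite /wprod big_cons; exact: mulr_gt0.
Qed.

Lemma wprod_ge_exp N (q : 'I_N.+1 -> R) (P : pred 'I_N.+1) a u :
  0 <= a -> (forall i, P i -> a <= q i) -> all P u -> a ^+ size u <= wprod q u.
Proof.
move=> a0 hq; elim: u => [|i u IH] /=; first by rewrite wprod_nil.
move=> /andP[Pi Pu]; rewrite /wprod big_cons exprS; apply: ler_pM => //.
- exact: exprn_ge0.
- exact: hq.
- exact: IH.
Qed.

Lemma wprod_le_exp N (q : 'I_N.+1 -> R) a u :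
  (forall i, 0 <= q i <= a) -> wprod q u <= a ^+ size u.
Proof.
move=> hq; elim: u => [|i u IH] /=; first by rewrite wprod_nil.
have /andP[q0 qa] := hq i.
rewrite /wprod big_cons exprS; apply: ler_pM => //.
by apply: wprod_ge0 => j; have /andP[] := hq j.
Qed.

Lemma mkseqD T (w : nat -> T) j k :
  mkseq w (j + k) = mkseq w j ++ mkseq (fun i => w (j + i)%N) k.
Proof.
rewrite /mkseq iotaD map_cat add0n; congr (_ ++ _).
by rewrite -[j in iota j k]addn0 iotaDl -map_comp.
Qed.

Lemma take_mkseq T (w : nat -> T) j k : (j <= k)%N -> take j (mkseq w k) = mkseq w j.
Proof. by move=> jk; rewrite -(subnKC jk) mkseqD take_size_cat ?size_mkseq. Qed.

End Words.

Section SelfSimilarSets.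
Context {R : realType} {n N : nat}.
Variables (ratio : 'I_N.+1 -> R) (f : 'I_N.+1 -> 'rV[R]_n -> 'rV[R]_n).
Variable E : set 'rV[R]_n.
Hypothesis simf : contracting_similitudes ratio f.
Hypothesis selfE : self_similar_set f E.

Definition wimage u := word_map f u @` E.

(** The estimates below concern every point of the nested images along a code;
[natural_projection] is one way of selecting such a point. *)
Definition codes (w : nat -> 'I_N.+1) x := forall k, wimage (mkseq w k) x.

Lemma ratio_gt0 i : 0 < ratio i.
Proof. by have [/andP[]] := simf i. Qed.

Lemma wratio_gt0 u : 0 < wprod ratio u.
Proof. by apply: wprod_gt0; apply/allP => i _; exact: ratio_gt0. Qed.

Lemma word_map_cat u v x : word_map f (u ++ v) x = word_map f u (word_map f v x).
Proof. by elim: u => //= i u IH; rewrite /= IH. Qed.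

Lemma word_map_dist u x y :
  enorm (word_map f u x - word_map f u y) = wprod ratio u * enorm (x - y).
Proof.
elim: u => [|i u IH] /=; first by rewrite wprod_nil mul1r.
by have [_ ->] := simf i; rewrite IH /wprod big_cons mulrA.
Qed.

Lemma word_map_affine u : exists Q : 'M[R]_n, exists b : 'rV[R]_n,
  Q *m Q^T = 1%:M /\ forall x, word_map f u x = wprod ratio u *: (x *m Q) + b.
Proof. exact: similitude_affine (wratio_gt0 u) (word_map_dist u). Qed.

Lemma word_map_onto u y : exists x, word_map f u x = y.
Proof.
have [Q [b [QQ h]]] := word_map_affine u.
exists ((wprod ratio u)^-1 *: ((y - b) *m Q^T)); rewrite h.
rewrite -scalemxAl -mulmxA (mulmx1C QQ) mulmx1 scalerA mulfV ?gt_eqF ?wratio_gt0 //.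
by rewrite scale1r subrK.
Qed.

Lemma word_map_continuous u : continuous (word_map f u).
Proof.
move=> x; have Fx : Filter (nbhs x) := nbhs_filter x.
apply/(@cvgrPdist_lt _ _ _ (nbhs x)) => e e0.
have K0 : 0 < wprod ratio u * (n%:R + 1) by rewrite mulr_gt0 ?wratio_gt0 // ltr_wpDl.
near=> y.
apply: (le_lt_trans (norm_le_enorm _)); rewrite word_map_dist.
apply: (@le_lt_trans _ _ (wprod ratio u * (n%:R + 1) * `|x - y|)).
  rewrite -mulrA; apply: ler_wpM2l; first exact: ltW (wratio_gt0 u).
  by apply: le_trans (enorm_le_norm _) _; rewrite ler_wpM2r // lerDl.
rewrite mulrC -ltr_pdivlMr //.
near: y; apply: cvgr_dist_lt => //; exact: divr_gt0.
Unshelve. all: by end_near. Qed.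

Lemma word_map_sub u x : E x -> E (word_map f u x).
Proof.
have [_ _ EE] := selfE.
elim: u x => //= i u IH x Ex; rewrite EE; exists i => //.
by exists (word_map f u x) => //; exact: IH.
Qed.

Lemma wimage_sub u v : wimage (u ++ v) `<=` wimage u.
Proof.
move=> _ [x Ex <-]; rewrite word_map_cat; exists (word_map f v x) => //.
exact: word_map_sub.
Qed.

Lemma wimage_compact u : compact (wimage u).
Proof.
have [_ cE _] := selfE; apply: continuous_compact => //.
by apply: continuous_subspaceT; exact: word_map_continuous.
Qed.

Lemma wimage_closed u : closed (wimage u).
Proof. by apply: compact_closed; [exact: norm_hausdorff|exact: wimage_compact]. Qed.

Lemma wimage_mkseq_sub (w : nat -> 'I_N.+1) j k :
  (j <= k)%N -> wimage (mkseq w k) `<=` wimage (mkseq w j).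
Proof. by move=> jk; rewrite -(subnKC jk) mkseqD; exact: wimage_sub. Qed.

Lemma natural_projection_codes w : codes w (natural_projection f E w).
Proof.
suff [x hx] : (\bigcap_k (word_map f (mkseq w k) @` E)) !=set0.
  by move=> k; rewrite /natural_projection; case: xgetP => [y _|/(_ x)//]; exact.
have [[a Ea] cE _] := selfE.
pose e k := word_map f (mkseq w k) a.
have eW j k : (j <= k)%N -> wimage (mkseq w j) (e k).
  by move=> jk; apply: (wimage_mkseq_sub jk); exists a.
have eE : (e @ \oo) E by exists 0%N => // k _; exact: word_map_sub.
have [x [Ex cx]] := cE (e @ \oo) _ eE.
exists x => j _; apply: wimage_closed => B xB; rewrite setIC.
have FW : (e @ \oo) (wimage (mkseq w j)) by exists j => // k /= jk; exact: eW.
by have [y [yW yB]] := cx (wimage (mkseq w j)) B FW xB; exists y.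
Qed.

Lemma self_similar_bounded : exists2 D : R, 0 < D & forall x y, E x -> E y -> enorm (x - y) <= D.
Proof.
have [_ cE _] := selfE.
have [M [_ hM]] := compact_bounded cE.
have EM x : E x -> `|x| <= `|M| + 1.
  by apply: hM; rewrite (le_lt_trans (ler_norm _)) // ltrDl.
exists (n%:R * ((`|M| + 1) *+ 2) + 1).
  by rewrite ltr_wpDl // mulr_ge0 // mulrn_wge0 // addr_ge0.
move=> x y Ex Ey; apply: (le_trans (enorm_le_norm _)).
apply: ler_wpDr => //; rewrite ler_wpM2l // mulr2n.
by apply: (le_trans (ler_normB _ _)); apply: lerD; exact: EM.
Qed.

Lemma wimage_dist D u x y : (forall x y, E x -> E y -> enorm (x - y) <= D) ->
  wimage u x -> wimage u y -> enorm (x - y) <= D * wprod ratio u.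
Proof.
move=> hD [x' Ex <-] [y' Ey <-].
by rewrite word_map_dist mulrC ler_wpM2r ?hD // ltW // wratio_gt0.
Qed.

Lemma ratio_bounds : exists rmin rmax : R,
  [/\ 0 < rmin, 0 < rmax < 1 & forall i, rmin <= ratio i <= rmax].
Proof.
have [i hi] := exists_minorant ratio.
have [j hj] := exists_minorant (fun i => - ratio i).
exists (ratio i), (ratio j); split; first exact: ratio_gt0.
  by have [] := simf j.
by move=> k; rewrite hi -lerN2 hj.
Qed.

End SelfSimilarSets.

(** * A universal word *)

Definition positive_word (R : realType) N (p : 'I_N.+1 -> R) : pred (seq 'I_N.+1) :=
  all (fun i => 0 < p i).

(** When [M] is an orthonormal frame of the orthogonal complement of [V], this
puts [y] in the cones around [x + V] of opening larger than [beta] and out of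
the cone in direction [theta] of parameter [beta]. The matrix [M] is arbitrary because
the frames are going to be rounded. *)
Definition cone_pair (R : realType) n m (M : 'M[R]_(n, m)) theta beta x y :=
  [/\ y != x, enorm ((y - x) *m M) <= beta * enorm (y - x)
    & dot (y - x) theta <= beta * enorm (y - x)].

Section UniversalWord.
Context {R : realType} {n m N : nat}.
Variables (ratio : 'I_N.+1 -> R) (f : 'I_N.+1 -> 'rV[R]_n -> 'rV[R]_n).
Variables (E : set 'rV[R]_n) (p : 'I_N.+1 -> R).
Hypothesis simf : contracting_similitudes ratio f.
Hypothesis selfE : self_similar_set f E.
Hypothesis flat_pairs : forall (M : 'M[R]_(n, m)) (c : R), 0 < c ->
  exists a b x y, [/\ forall k, positive_word p (mkseq a k),
    forall k, positive_word p (mkseq b k), codes f E a x, codes f E b y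
    & enorm ((y - x) *m M) < c * enorm (y - x)].

(** A word map is a dilation composed with an isometry, which only rotates
[M] and [theta]. *)
Lemma cone_pair_word_map u (M : 'M[R]_(n, m)) (theta : 'rV[R]_n) :
  exists (M' : 'M[R]_(n, m)) (theta' : 'rV[R]_n), (forall beta x y,
    cone_pair M theta beta (word_map f u x) (word_map f u y) <->
    cone_pair M' theta' beta x y) /\
  ((forall z, enorm (z *m M) <= enorm z) -> forall z, enorm (z *m M') <= enorm z) /\
  enorm theta' = enorm theta.
Proof.
have [Q [b [QQ h]]] := word_map_affine simf u.
exists (Q *m M), (theta *m Q^T); split; last first.
  split; first by move=> hM z; rewrite mulmxA -(enorm_orthomx z QQ).
  by rewrite enorm_orthomx // trmxK (mulmx1C QQ).
move=> beta x y; set rho := wprod ratio u in h.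
have rho0 : 0 < rho := wratio_gt0 simf u.
have d : word_map f u y - word_map f u x = rho *: ((y - x) *m Q).
  by rewrite !h opprD addrACA subrr addr0 mulmxBl scalerBr.
have dn : enorm (word_map f u y - word_map f u x) = rho * enorm (y - x).
  exact: word_map_dist.
have e1 : (word_map f u y != word_map f u x) = (y != x).
  by rewrite -subr_eq0 -enorm_eq0 dn mulf_eq0 gt_eqF //= enorm_eq0 subr_eq0.
have e2 : enorm ((word_map f u y - word_map f u x) *m M) =
    rho * enorm ((y - x) *m (Q *m M)).
  by rewrite d -scalemxAl enormZ gtr0_norm // mulmxA.
have e3 : dot (word_map f u y - word_map f u x) theta =
    rho * dot (y - x) (theta *m Q^T).
  by rewrite d dotZl dot_mulmxl.
by rewrite /cone_pair e1 e2 e3 dn !(mulrCA beta) !(ler_pM2l rho0).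
Qed.

(** Of two points [x] and [y], one sees the other at an obtuse or right angle
with [theta]; the condition on [M] being symmetric, their roles may be exchanged
to make it [x]. Long prefixes of the codes of [x] and [y] then confine the
points to balls in which both conditions persist. *)
Lemma local_cone_pair (M : 'M[R]_(n, m)) (theta : 'rV[R]_n) (beta : R) : 0 < beta ->
  exists u v, [/\ positive_word p u, positive_word p v &
    forall x y, wimage f E u x -> wimage f E v y -> cone_pair M theta beta x y].
Proof.
move=> beta0; have [a [b [x [y [pa pb ax bY xyM]]]]] := flat_pairs M (divr_gt0 beta0 (ltr0Sn R 1)).
wlog xyt : a b x y pa pb ax bY xyM / dot (y - x) theta <= 0.
  move=> H; have [h|h] := lerP (dot (y - x) theta) 0; first exact: (H a b x y).
  apply: (H b a y x) => //.
    by rewrite -[x - y]opprB mulNmx !enormN.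
  by rewrite -opprB dotNl oppr_le0 ltW.
have [D D0 hD] := self_similar_bounded selfE.
have [rmin [rmax [_ /andP[rm0 rm1] rb]]] := ratio_bounds simf.
set L := (\sum_j \sum_i `|M i j|) + enorm theta.
have SM0 : 0 <= \sum_j \sum_i `|M i j| by apply: sumr_ge0 => j _; apply: sumr_ge0.
have L0 : 0 <= L by rewrite addr_ge0 // enorm_ge0.
have LM z : enorm (z *m M) <= L * enorm z.
  by apply: (le_trans (enorm_mulmx_le _ _)); rewrite ler_wpM2r ?enorm_ge0 // lerDl enorm_ge0.
have Lt (z : 'rV[R]_n) : dot z theta <= L * enorm z.
  by apply: (le_trans (dot_le_norm _ _)); rewrite mulrC ler_wpM2r ?enorm_ge0 // lerDr.
have d0 : 0 < enorm (y - x).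
  by have := le_lt_trans (enorm_ge0 _) xyM; rewrite pmulr_rgt0 ?divr_gt0.
set d := enorm (y - x) in xyM d0.
(* Moving [x] and [y] by at most [eta] changes both quantities to be bounded by
   at most [2 * L * eta], and the distance [d] by at most [2 * eta]. *)
pose eta := beta * d / (4 * (L + beta)).
have Lb0 : 0 < L + beta by rewrite ltr_wpDl.
have eta0 : 0 < eta by rewrite divr_gt0 ?mulr_gt0.
have etaE : 4 * eta * (L + beta) = beta * d.
  by rewrite /eta; field; rewrite gt_eqF.
have [|q hq] := @geometric_small R rmax D eta _ eta0; first by rewrite ltW.
have small (w : nat -> 'I_N.+1) z z' : codes f E w z -> wimage f E (mkseq w q) z' ->
    enorm (z' - z) <= eta.
  move=> /(_ q) wz wz'; apply: (le_trans (wimage_dist simf hD wz' wz)).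
  apply: le_trans hq; apply: ler_wpM2l; first exact: ltW.
  rewrite -[q in leRHS](size_mkseq w); apply: wprod_le_exp => i.
  by have /andP[_ ->] := rb i; rewrite ltW // (ratio_gt0 simf).
exists (mkseq a q), (mkseq b q); split; [exact: pa|exact: pb|move=> x' y' ax' by'].
have hx := small _ _ _ ax ax'; have hy := small _ _ _ bY by'.
pose e := (y' - y) - (x' - x).
have zE : y' - x' = (y - x) + e by apply/rowP => i; rewrite !mxE; ring.
have he : enorm e <= 2 * eta.
  by apply: (le_trans (ler_enormD _ _)); rewrite enormN; lra.
have hLe : L * enorm e <= L * (2 * eta) by rewrite ler_wpM2l.
have hz : d - 2 * eta <= enorm (y' - x').
  have := ler_enormD (y' - x') (- e); rewrite {1}zE addrK enormN -/d; lra.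
have hz' : beta * (d - 2 * eta) <= beta * enorm (y' - x') by rewrite ler_wpM2l // ltW.
have Le0 : 0 <= L * eta by rewrite mulr_ge0 // ltW.
have be0 : 0 <= beta * eta by rewrite mulr_ge0 // ltW.
split.
- rewrite -subr_eq0 -enorm_eq0 gt_eqF // (lt_le_trans _ hz) // subr_gt0.
  by rewrite -(ltr_pM2l beta0); nra.
- apply: le_trans hz'; rewrite zE mulmxDl; apply: (le_trans (ler_enormD _ _)).
  by have := LM e; nra.
- apply: le_trans hz'; rewrite zE dotDl.
  by have := Lt e; nra.
Qed.

(** Concatenating local words serves finitely many pairs [(M, theta)] at once:
seen from inside the image under the word built so far, a pair is replaced by a
rotated one, for which a further local word exists. *)
Lemma finite_universal_word (s : seq ('M[R]_(n, m) * 'rV[R]_n)) (beta : R) : 0 < beta ->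
  exists u c, [/\ positive_word p u, 0 < c & forall M theta, (M, theta) \in s ->
    exists v, [/\ positive_word p v, c <= wprod p v &
    forall x y, wimage f E u x -> wimage f E v y -> cone_pair M theta beta x y]].
Proof.
move=> beta0; elim: s => [|[M theta] s [u [c [pu c0 hs]]]].
  by exists [::], 1; split.
have [M' [theta' [pull _]]] := cone_pair_word_map u M theta.
have [u' [v' [pu' pv' huv]]] := local_cone_pair M' theta' beta0.
have puv : positive_word p (u ++ v') by rewrite /positive_word all_cat; apply/andP.
exists (u ++ u'), (Num.min c (wprod p (u ++ v'))); split.
- by rewrite /positive_word all_cat; apply/andP.
- by rewrite lt_min c0 wprod_gt0.
move=> M1 theta1; rewrite inE => /orP[/eqP[-> ->]|/hs[v [pv cv hv]]].
  exists (u ++ v'); split=> // [|_ _ [x Ex <-] [y Ey <-]].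
    by rewrite ge_min lexx orbT.
  rewrite !word_map_cat; apply/pull.
  by apply: huv; [exists x|exists y].
exists v; split=> // [|x y xu yv]; first by rewrite ge_min cv.
by apply: hv => //; apply: wimage_sub xu.
Qed.

(** Rounding the entries of [M] and [theta] reduces the whole compact family to
finitely many pairs, at the price of passing from [alpha / 2] to [alpha]. *)
Lemma universal_word (alpha : R) : 0 < alpha ->
  exists u c, [/\ positive_word p u, 0 < c & forall (M : 'M[R]_(n, m)) (theta : 'rV[R]_n),
    (forall z, enorm (z *m M) <= enorm z) -> enorm theta <= 1 ->
    exists v, [/\ positive_word p v, c <= wprod p v & forall x y,
      wimage f E u x -> wimage f E v y -> cone_pair M theta alpha x y]].
Proof.
move=> alpha0.
pose K : R := (m%:R * n%:R + n%:R + 1) * 4.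
have mn0 : 0 <= m%:R * n%:R :> R by rewrite mulr_ge0.
have n0 : 0 <= n%:R :> R by [].
have K0 : 0 < K by rewrite /K; lra.
have eta0 : 0 < alpha / K by rewrite divr_gt0.
have etaE : (m%:R * n%:R + n%:R + 1) * (alpha / K) = alpha / 4.
  by rewrite /K; field; lra.
have [sM hM] := @bounded_matrix_net R n m _ eta0.
have [st ht] := @bounded_matrix_net R 1 n _ eta0.
have [u [c [pu c0 hu]]] :=
  finite_universal_word [seq (M, t) | M <- sM, t <- st] (divr_gt0 alpha0 (ltr0Sn R 1)).
exists u, c; split=> // M theta M1 t1.
have [M' sM' MM'] := hM M (fun i j => entry_le1_contraction i j M1).
have [|t' st' tt'] := ht theta.
  move=> i j; rewrite (ord1 i); apply: le_trans t1; exact: abs_coord_le_enorm.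
have [v [pv cv hv]] := hu _ _ (allpairs_f pair sM' st').
exists v; split=> // x y xu yv; have [yx hyM hyt] := hv x y xu yv.
have z0 : 0 < enorm (y - x) by rewrite enorm_gt0 subr_eq0.
have dM : enorm ((y - x) *m (M - M')) <= m%:R * n%:R * (alpha / K) * enorm (y - x).
  apply: (le_trans (enorm_mulmx_le _ _)); rewrite ler_wpM2r ?enorm_ge0 //.
  have -> : m%:R * n%:R * (alpha / K) = \sum_(j < m) \sum_(i < n) alpha / K.
    by rewrite !sumr_const !card_ord -[RHS]mulr_natl -mulrA; congr (_ * _); exact: mulr_natl.
  by apply: ler_sum => j _; apply: ler_sum => i _; rewrite !mxE; exact: MM'.
have dt : dot (y - x) (theta - t') <= n%:R * (alpha / K) * enorm (y - x).
  apply: (le_trans (dot_le_norm _ _)); rewrite mulrC ler_wpM2r ?enorm_ge0 //.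
  apply: (le_trans (enorm_le_sum _)).
  have -> : n%:R * (alpha / K) = \sum_(i < n) alpha / K by rewrite sumr_const card_ord mulr_natl.
  by apply: ler_sum => i _; rewrite !mxE; exact: tt'.
have b1 : 0 <= m%:R * n%:R * (alpha / K) * enorm (y - x).
  by apply: mulr_ge0 (enorm_ge0 _); apply: mulr_ge0 (ltW eta0).
have b2 : 0 <= n%:R * (alpha / K) * enorm (y - x).
  by apply: mulr_ge0 (enorm_ge0 _); apply: mulr_ge0 (ltW eta0).
have b3 : 0 <= (alpha / K) * enorm (y - x) by apply: mulr_ge0 (ltW eta0) (enorm_ge0 _).
have b4 : 0 < alpha * enorm (y - x) by rewrite mulr_gt0.
have := congr1 (fun t => t * enorm (y - x)) etaE; rewrite !mulrDl mul1r => b5.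
have b6 : alpha / 4 * enorm (y - x) = (alpha * enorm (y - x)) / 4 by field.
have b7 : alpha / 2 * enorm (y - x) = (alpha * enorm (y - x)) / 2 by field.
split=> //.
- rewrite -[M](subrK M') mulmxDr; apply: (le_trans (ler_enormD _ _)); lra.
- rewrite -[theta](subrK t') dotDr; lra.
Qed.

End UniversalWord.

(** * Bernoulli measures *)

Definition word_event N k (P : pred (seq 'I_N.+1)) : set (nat -> 'I_N.+1) :=
  [set w | P (mkseq w k)].

Definition has_block N (u : seq 'I_N.+1) j b (s : seq 'I_N.+1) :=
  has (fun i => take (size u) (drop (j + i * size u) s) == u) (iota 0 b).

Section Bernoulli.
Context {R : realType} {N : nat}.
Variable p : 'I_N.+1 -> R.
Variable nu : {measure set code_space N -> \bar R}.
Hypothesis probp : probability_vector p.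
Hypothesis bernu : bernoulli_measure p nu.

Lemma wprod_prob_le1 u : wprod p u <= 1.
Proof.
rewrite -(expr1n _ (size u)); apply: wprod_le_exp => i.
have [p0 p1] := probp; rewrite p0 -p1 (bigD1 i) //= lerDl.
by apply: sumr_ge0 => j _.
Qed.

Lemma bernoulli_setT : nu setT = 1%E.
Proof.
have -> : [set: nat -> 'I_N.+1] = cylinder [::] by apply/seteqP; split.
by rewrite bernu big_nil.
Qed.

Lemma cylinder_measurable u : measurable (cylinder u : set (code_space N)).
Proof. by apply: sub_sigma_algebra; exists u. Qed.

(** Events read off the first [k] letters are finite unions of cylinders, and
they are independent of the letters that follow. *)
Lemma nu_word_extension k (P : pred (seq 'I_N.+1)) (v : seq 'I_N.+1) :
  measurable ([set w | P (mkseq w k) /\ mkseq w (k + size v) = mkseq w k ++ v]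
    : set (code_space N)) /\
  nu [set w | P (mkseq w k) /\ mkseq w (k + size v) = mkseq w k ++ v] =
  (\sum_(t : k.-tuple 'I_N.+1 | P t) wprod p (t ++ v))%:E.
Proof.
pose s := [seq t <- enum {: k.-tuple 'I_N.+1} | P (tval t)].
pose F (t : k.-tuple 'I_N.+1) : set (code_space N) := cylinder (t ++ v).
have -> : [set w | P (mkseq w k) /\ mkseq w (k + size v) = mkseq w k ++ v] =
    \bigcup_(t in [set` s]) F t.
  apply/seteqP; split => [w [Pw wv]|w [t /= ts]].
    have sz : size (mkseq w k) == k by rewrite size_mkseq.
    exists (Tuple sz); first by rewrite /= mem_filter mem_enum /= Pw.
    by rewrite /F /cylinder /= size_cat size_mkseq.
  move: ts; rewrite mem_filter => /andP[Pt _].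
  rewrite /F /cylinder /= size_cat size_tuple => wt.
  have wk : mkseq w k = t.
    by rewrite -(take_mkseq w (leq_addr (size v) k)) wt take_size_cat ?size_tuple.
  by rewrite wk.
have fs : finite_set [set` s] by exact: finite_seq.
have mF t : [set` s] t -> measurable (F t) by move=> _; exact: cylinder_measurable.
split; first exact: fin_bigcup_measurable.
rewrite measure_fin_bigcup //; last first.
  move=> t1 t2 _ _ [w [w1 w2]]; apply/val_inj.
  have e1 : mkseq w k = t1.
    rewrite -(take_mkseq w (leq_addr (size v) k)).
    by rewrite -[(k + _)%N](size_tuple (cat_tuple t1 (in_tuple v))) w1 take_size_cat ?size_tuple.
  have e2 : mkseq w k = t2.
    rewrite -(take_mkseq w (leq_addr (size v) k)).
    by rewrite -[(k + _)%N](size_tuple (cat_tuple t2 (in_tuple v))) w2 take_size_cat ?size_tuple.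
  by rewrite /= -e1.
rewrite -fsbig_seq; last by rewrite filter_uniq // enum_uniq.
rewrite big_filter big_enum_cond /= -sumEFin.
by apply: eq_bigr => t _; rewrite bernu.
Qed.

Lemma word_event0 k (P : pred (seq 'I_N.+1)) : word_event k P =
  [set w | P (mkseq w k) /\ mkseq w (k + size (Nil 'I_N.+1)) = mkseq w k ++ [::]].
Proof. by apply/seteqP; split => [w Pw|w []//]; split=> //; rewrite addn0 cats0. Qed.

Lemma word_event_measurable k P : measurable (word_event k P : set (code_space N)).
Proof. by rewrite word_event0; case: (nu_word_extension k P [::]). Qed.

Lemma nu_word_event k (P : pred (seq 'I_N.+1)) :
  nu (word_event k P) = (\sum_(t : k.-tuple 'I_N.+1 | P t) wprod p t)%:E.
Proof.
rewrite word_event0; case: (nu_word_extension k P [::]) => _ ->.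
by congr EFin; apply: eq_bigr => t _; rewrite cats0.
Qed.

Lemma nu_nonpositive_word k : nu (word_event k (predC (positive_word p))) = 0%E.
Proof.
rewrite nu_word_event big1 // => t /= /allPn[i it]; rewrite -leNgt => pi.
rewrite /wprod (big_rem i) //=.
have [p0 _] := probp.
have pi0 : p i = 0 by apply/eqP; rewrite eq_le pi p0.
by rewrite pi0 mul0r.
Qed.

Lemma take_drop_mkseq (w : nat -> 'I_N.+1) a l k : (a + l <= k)%N ->
  take l (drop a (mkseq w k)) = mkseq (fun i => w (a + i)%N) l.
Proof.
move=> alk; have ak : (a <= k)%N by apply: leq_trans alk; rewrite leq_addr.
rewrite -{1}(subnKC ak) mkseqD drop_size_cat ?size_mkseq // take_mkseq //.
by rewrite leq_subRL.
Qed.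

Lemma has_blockP u j b (w : nat -> 'I_N.+1) :
  has_block u j b (mkseq w (j + b * size u)) <->
  exists2 i, (i < b)%N & mkseq w (j + i * size u + size u) = mkseq w (j + i * size u) ++ u.
Proof.
have bnd i : (i < b)%N -> (j + i * size u + size u <= j + b * size u)%N.
  by move=> ib; rewrite -addnA leq_add2l addnC -mulSn leq_mul2r ib orbT.
split=> [/hasP[i]|[i ib wi]].
  rewrite mem_iota add0n => /andP[_ ib] /eqP; rewrite take_drop_mkseq ?bnd // => ui.
  by exists i => //; rewrite mkseqD ui.
apply/hasP; exists i; rewrite ?mem_iota // take_drop_mkseq ?bnd //.
by move: wi; rewrite mkseqD => /eqP; rewrite eqseq_cat // eqxx.
Qed.

(** Disjoint blocks are independent. *)
Lemma nu_miss_block u j b :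
  nu (word_event (j + b * size u) (fun s => ~~ has_block u j b s)) =
  ((1 - wprod p u) ^+ b)%:E.
Proof.
pose A c := word_event (j + c * size u) (fun s => ~~ has_block u j c s).
rewrite -/(A b); elim: b => [|b IH].
  rewrite expr0 -bernoulli_setT; congr (nu _).
  by apply/seteqP; split.
pose k := (j + b * size u)%N.
pose P : pred (seq 'I_N.+1) := fun s => ~~ has_block u j b s.
pose B : set (code_space N) := [set w | P (mkseq w k) /\ mkseq w (k + size u) = mkseq w k ++ u].
have [mB nB] := nu_word_extension k P u; rewrite -/B in mB nB.
have mA c : measurable (A c : set (code_space N)) by exact: word_event_measurable.
have AB : A b = A b.+1 `|` B.
  apply/seteqP; split => w.
    move=> /negP wb; have [we|wne] := pselect (mkseq w (k + size u) = mkseq w k ++ u).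
      by right; split=> //; apply/negP.
    left; apply/negP => /has_blockP[i]; rewrite ltnS leq_eqVlt => /orP[/eqP ->//|ib wi].
    by apply: wb; apply/has_blockP; exists i.
  move=> [/negP wb|[]//]; apply/negP => /has_blockP[i ib wi]; apply: wb.
  by apply/has_blockP; exists i => //; rewrite ltnS ltnW.
have AB0 : A b.+1 `&` B = set0.
  apply/seteqP; split => // w [/negP wb [_ wu]]; apply: wb.
  by apply/has_blockP; exists b.
have E : nu (A b) = (nu (A b.+1) + nu B)%E by rewrite AB measureU //; exact: mA.
move: E; rewrite nB IH.
have -> : \sum_(t : k.-tuple 'I_N.+1 | P t) wprod p (t ++ u) = (1 - wprod p u) ^+ b * wprod p u.
  have := nu_word_event k P; rewrite -/(A b) IH => -[->].
  by rewrite mulr_suml; apply: eq_bigr => t _; rewrite wprod_cat.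
have [fA] : nu (A b.+1) \is a fin_num.
  rewrite ge0_fin_numE // (@le_lt_trans _ _ (nu setT)) ?bernoulli_setT ?ltry //.
  by rewrite -bernoulli_setT le_measure ?inE.
move=> /(congr1 fine); rewrite fineD //= => h.
rewrite -(fineK fA); congr EFin; rewrite exprS; lra.
Qed.

End Bernoulli.

(** * Self-similar measures and codes of almost every point *)

Section Koenig.
Context {N : nat}.

(** Koenig's lemma: a word with admissible extensions of every length keeps this
property after some letter is added to it, there being finitely many letters. *)
Lemma infinite_branch (T : seq 'I_N.+1 -> Prop) :
  (forall s t, T (s ++ t) -> T s) -> (forall l, exists2 t, size t = l & T t) ->
  exists w, forall k, T (mkseq w k).
Proof.
move=> Tpre Tinf.
pose alive s := forall l, exists2 t, size t = l & T (s ++ t).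
have step s : alive s -> exists i, alive (rcons s i).
  move=> sA; apply: contrapT => /forallNP H.
  have /choice[L hL] : forall i, exists l, forall t, size t = l -> ~ T (rcons s i ++ t).
    move=> i; have /existsNP[l hl] := H i; exists l => t tl Tt; apply: hl; by exists t.
  have [[//|i t] [tl] Tt] := sA (\max_i L i).+1.
  apply: (hL i (take (L i) t)).
    by rewrite size_takel // tl; exact: leq_bigmax.
  apply: (Tpre _ (drop (L i) t)).
  by rewrite -catA cat_take_drop -cats1 -catA.
have /choice[g hg] : forall s, exists i, alive s -> alive (rcons s i).
  move=> s; have [sA|sA] := pselect (alive s); last by exists ord0.
  by have [i hi] := step s sA; exists i.
pose branch := fix branch k := if k is k'.+1 then rcons (branch k') (g (branch k')) else [::].
exists (fun k => g (branch k)) => k.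
have -> : mkseq (fun k => g (branch k)) k = branch k.
  by elim: k => // k IH; rewrite mkseqS IH.
have /(_ 0%N)[t /size0nil ->] : alive (branch k).
  elim: k => [l|k IH] /=; last exact: hg.
  by have [t tl Tt] := Tinf l; exists t.
by rewrite cats0.
Qed.

End Koenig.

Section SelfSimilarMeasures.
Context {R : realType} {n N : nat}.
Variables (ratio : 'I_N.+1 -> R) (f : 'I_N.+1 -> 'rV[R]_n -> 'rV[R]_n).
Variables (E : set 'rV[R]_n) (p : 'I_N.+1 -> R).
Variable mu : {measure set borelRn R n -> \bar R}.
Variable nu : {measure set code_space N -> \bar R}.
Hypothesis simf : contracting_similitudes ratio f.
Hypothesis selfE : self_similar_set f E.
Hypothesis probp : probability_vector p.
Hypothesis bernu : bernoulli_measure p nu.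
Hypothesis hmu : forall A : set (borelRn R n), measurable A ->
  mu A = pushforward nu (natural_projection f E : code_space N -> borelRn R n) A.

Lemma open_borel (A : set 'rV[R]_n) : open A -> measurable (A : set (borelRn R n)).
Proof. by move=> oA; exact: sub_sigma_algebra. Qed.

Lemma closed_borel (A : set 'rV[R]_n) : closed A -> measurable (A : set (borelRn R n)).
Proof.
move=> cA; rewrite -(setCK A); apply: measurableC; apply: open_borel.
exact: closed_openC.
Qed.

(** The preimage of an open set is the union of the cylinders of the words [u]
with the image of [E] under [u] inside the set, and there are countably many
words. *)
Lemma natural_projection_measurable :
  measurable_fun setT (natural_projection f E : code_space N -> borelRn R n).
Proof.
apply: (@measurability _ _ (code_space N) (borelRn R n) setT _ (@open 'rV[R]_n)); first by [].
move=> _ [G oG <-]; rewrite setTI.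
have [D D0 hD] := self_similar_bounded selfE.
have [rmin [rmax [_ /andP[rm0 rm1] rb]]] := ratio_bounds simf.
have -> : natural_projection f E @^-1` G =
    \bigcup_(u : seq 'I_N.+1) [set w | wimage f E u `<=` G /\ cylinder u w].
  apply/seteqP; split => [w /= Gw|w [u _ [uG wu]]]; last first.
    apply: uG; have := natural_projection_codes simf selfE w (size u).
    by rewrite wu.
  have /nbhs_ballP[e /= e0 eG] := open_nbhs_nbhs (conj oG Gw).
  have e20 : 0 < e / 2 by rewrite divr_gt0.
  have [|q hq] := @geometric_small R rmax D (e / 2) _ e20; first by rewrite ltW.
  exists (mkseq w q) => //; split; last by rewrite /cylinder /= size_mkseq.
  move=> y hy; apply: eG; rewrite -ball_normE /ball_ /=.
  apply: (le_lt_trans (norm_le_enorm _)).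
  apply: (le_lt_trans (wimage_dist simf hD (natural_projection_codes simf selfE w q) hy)).
  apply: (@le_lt_trans _ _ (e / 2)); last by rewrite ltr_pdivrMr // ltr_pMr // ltr1n.
  apply: le_trans hq; apply: ler_wpM2l; first exact: ltW.
  rewrite -[q in leRHS](size_mkseq w); apply: wprod_le_exp => i.
  by have /andP[_ ->] := rb i; rewrite ltW // (ratio_gt0 simf).
apply: countable_bigcupT_measurable => // u.
have [uG|uG] := pselect (wimage f E u `<=` G).
  rewrite (_ : [set w | _ /\ _] = cylinder u); first exact: cylinder_measurable.
  by apply/seteqP; split => [w []|w].
rewrite (_ : [set w | _ /\ _] = set0); first exact: measurable0.
by apply/seteqP; split => [w []|w].
Qed.

Lemma mu_preimage (A : set 'rV[R]_n) : measurable (A : set (borelRn R n)) ->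
  measurable (natural_projection f E @^-1` A : set (code_space N)) /\
  mu A = nu (natural_projection f E @^-1` A).
Proof.
move=> mA; split; last exact: hmu.
by rewrite -[_ @^-1` _]setTI; exact: natural_projection_measurable.
Qed.

Lemma mu_setT : mu setT = 1%E.
Proof. by rewrite hmu // /pushforward preimage_setT (bernoulli_setT bernu). Qed.

Lemma mu_fin (A : set 'rV[R]_n) : measurable (A : set (borelRn R n)) ->
  mu A \is a fin_num.
Proof.
move=> mA; rewrite ge0_fin_numE // (@le_lt_trans _ _ (mu setT)) ?mu_setT ?ltry //.
by rewrite -mu_setT le_measure ?inE.
Qed.

Lemma mu_ge_wimage u (A : set 'rV[R]_n) : measurable (A : set (borelRn R n)) ->
  wimage f E u `<=` A -> ((wprod p u)%:E <= mu A)%E.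
Proof.
move=> mA uA; have [mpA ->] := mu_preimage mA.
rewrite -[(wprod p u)%:E](bernu u); apply: le_measure; rewrite ?inE //.
  exact: cylinder_measurable.
move=> w wu; apply: uA; rewrite -wu; exact: natural_projection_codes.
Qed.

(** The exceptional set is Borel because the points having a code all of whose
prefixes are admissible are, by Koenig's lemma, those that lie, at each length,
in the image of [E] under some admissible word: a countable intersection of
finite unions of compact sets. *)
Lemma ae_codes (len : nat -> nat) (cond : nat -> pred (seq 'I_N.+1)) :
  (\sum_(0 <= k <oo) nu (word_event (len k) (predC (cond k))) < +oo)%E ->
  exists Z : set (borelRn R n), [/\ measurable Z, mu Z = 0%E &
    forall x, ~ Z x -> exists w j, codes f E w x /\
      forall k, (j <= k)%N -> cond k (mkseq w (len k))].
Proof.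
move=> sumfin.
pose adm j s := forall k, (j <= k)%N -> (len k <= size s)%N -> cond k (take (len k) s).
pose K j := \bigcap_l \bigcup_(t in [set t : l.-tuple 'I_N.+1 | adm j t]) wimage f E t.
have mK j : measurable (K j : set (borelRn R n)).
  apply: bigcap_measurable => // l _; apply: closed_borel.
  by apply: closed_bigcup => [|t _]; [exact: finite_finset|exact: (wimage_closed simf selfE)].
have mZ : measurable (~` (\bigcup_j K j) : set (borelRn R n)).
  by apply: measurableC; apply: bigcup_measurable.
exists (~` (\bigcup_j K j)); split => //.
  have [mpZ ->] := mu_preimage mZ.
  apply: (subset_measure0 mpZ) (lim_sup_set_cvg0 _ sumfin).
  - apply: bigcap_measurable => // i _; apply: bigcup_measurable => j _.
    exact: word_event_measurable.
  - move=> w /= wZ j _; apply: contrapT => wj; apply: wZ; exists j => // l _.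
    have sl : size (mkseq w l) == l by rewrite size_mkseq.
    exists (Tuple sl) => /=; last exact: natural_projection_codes.
    move=> k jk; rewrite size_mkseq => kl; rewrite take_mkseq //.
    by apply: contrapT => /negP nc; apply: wj; exists k.
  - by move=> k; exact: word_event_measurable.
move=> x /contrapT[j _ Kx].
have [| |w hw] := @infinite_branch N (fun s => adm j s /\ wimage f E s x).
- move=> s t [sta stx]; split; last exact: wimage_sub stx.
  move=> k jk ks; have := sta k jk; rewrite size_cat takel_cat //.
  by apply; rewrite (leq_trans ks) // leq_addr.
- move=> l; have [t /= ta tx] := Kx l I.
  by exists t => //; rewrite size_tuple.
exists w, j; split=> [k|k jk]; first by have [] := hw k.
have [ha _] := hw (len k); have := ha k jk.
by rewrite size_mkseq take_mkseq //; apply.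
Qed.

(** Almost every code has letters of positive weight only, so the points with
such codes form a set that is not negligible. Were the conclusion false, this set would be a
Lipschitz graph over a subset of [R^m], hence rectifiable. *)
Lemma flat_pairs_of_unrectifiable m : purely_unrectifiable m mu ->
  forall (M : 'M[R]_(n, m)) (c : R), 0 < c ->
  exists a b x y, [/\ forall k, positive_word p (mkseq a k),
    forall k, positive_word p (mkseq b k), codes f E a x, codes f E b y
    & enorm ((y - x) *m M) < c * enorm (y - x)].
Proof.
move=> unr M c c0; apply: contrapT => H.
pose A := [set natural_projection f E w | w in
  [set w | forall k, positive_word p (mkseq w k)]].
have rA : rectifiable m A.
  apply: (rectifiable_lip_graph (M := M) c0) => _ _ [a pa <-] [b pb <-].
  rewrite leNgt; apply/negP => h; apply: H.
  exists b, a, (natural_projection f E b), (natural_projection f E a).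
  by split=> //; exact: natural_projection_codes.
have [B [mB B0 AB]] := unr A rA.
have [mpB] := mu_preimage mB; rewrite B0 => nB.
pose Npos k : set (code_space N) := word_event k (predC (positive_word p)).
have mN k : measurable (Npos k) by exact: word_event_measurable.
have N0 : nu (\bigcup_k Npos k) = 0%E.
  apply/eqP; rewrite -measure_le0; apply: le_trans (measure_sigma_subadditive nu _ _ _) _.
  - exact: mN.
  - exact: bigcup_measurable.
  - by [].
  - by rewrite eseries0 // => k _ _; exact: nu_nonpositive_word probp bernu k.
have : (nu setT <= nu (natural_projection f E @^-1` B `|` \bigcup_k Npos k))%E.
  apply: le_measure; rewrite ?inE //; first by apply: measurableU => //; exact: bigcup_measurable.
  move=> w _; have [pw|/existsNP[k /negP pw]] := pselect (forall k, positive_word p (mkseq w k)).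
    by left; apply: AB; exists w.
  by right; exists k.
have mU : measurable (\bigcup_k Npos k : set (code_space N)) by exact: bigcup_measurable.
move=> /le_trans/(_ (measureU2 nu mpB mU)) h.
have : (nu setT <= nu (natural_projection f E @^-1` B) + nu (\bigcup_k Npos k))%E := h.
by rewrite (bernoulli_setT bernu) -nB N0 add0e lee_fin ler10.
Qed.

End SelfSimilarMeasures.

(** * Bounded overlap under the open set condition *)

Section Overlap.
Context {R : realType} {n N : nat}.
Variables (ratio : 'I_N.+1 -> R) (f : 'I_N.+1 -> 'rV[R]_n -> 'rV[R]_n).
Hypothesis simf : contracting_similitudes ratio f.

(** At the first letter where two words of equal length differ, the disjoint
images of [U] under the two letters keep the images of [U] apart. *)
Lemma word_images_disjoint (U : set 'rV[R]_n) u v a b :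
  \bigcup_i (f i @` U) `<=` U -> trivIset setT (fun i => f i @` U) ->
  size u = size v -> U a -> U b -> word_map f u a = word_map f v b -> u = v.
Proof.
move=> fU tU suv Ua Ub.
have wU w c : U c -> U (word_map f w c).
  by move=> Uc; elim: w => //= i w IH; apply: fU; exists i => //; exists (word_map f w c).
elim: u v suv => [|i u IH] [|j v] //= [suv] e.
have ij : i = j.
  apply: tU => //; exists (f i (word_map f u a)); split.
    by exists (word_map f u a) => //; exact: wU.
  by rewrite e; exists (word_map f v b) => //; exact: wU.
subst j; congr cons; apply: IH => //.
have [_ hi] := simf i.
have := hi (word_map f u a) (word_map f v b); rewrite e subrr enorm0 => /esym/eqP.
by rewrite mulf_eq0 gt_eqF ?(ratio_gt0 simf) //= enorm_eq0 subr_eq0 => /eqP.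
Qed.

(** Two words with the same letter counts have the same contraction ratio
[rho], so the images under them of a ball contained in the open set are
disjoint balls of the same radius; recording the cell, in a grid of mesh
proportional to [rho], of the centre therefore separates the words with given
letter counts. *)
Lemma overlap_card : open_set_condition f -> forall (x0 : 'rV[R]_n) (K : R), 0 < K ->
  exists c : nat, forall k y,
  (#|[set t : k.-tuple 'I_N.+1 |
      (enorm (word_map f t x0 - y) <= K * wprod ratio t)%R]%SET| <= k.+1 ^ N.+1 * c)%N.
Proof.
move=> [U [[z0 Uz0] oU fU tU]] x0 K K0.
have /nbhs_ballP[delta /= d0 dU] := open_nbhs_nbhs (conj oU Uz0).
pose K2 := K + enorm (z0 - x0).
have K20 : 0 < K2 by rewrite ltr_pwDl // enorm_ge0.
pose L := (n%:R + 1) / delta.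
have L0 : 0 < L by rewrite divr_gt0 // ltr_wpDl.
pose Q := Num.truncn (2 * K2 * L).
exists (Q.+1 ^ n)%N => k y; set A := [set t | _]%SET.
pose cell (t : k.-tuple 'I_N.+1) (i : 'I_n) : nat :=
  Num.truncn (((word_map f t z0 - y) ord0 i / wprod ratio t + K2) * L).
pose h (t : k.-tuple 'I_N.+1) : {ffun 'I_N.+1 -> 'I_k.+1} * {ffun 'I_n -> 'I_Q.+1} :=
  ([ffun i => inord (count_mem i t)], [ffun i => inord (cell t i)]).
have cellP t i : t \in A -> 0 <= ((word_map f t z0 - y) ord0 i / wprod ratio t + K2) * L /\
    (cell t i < Q.+1)%N.
  rewrite inE => tA; have r0 := wratio_gt0 simf t.
  have : enorm (word_map f t z0 - y) <= K2 * wprod ratio t.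
    apply: (le_trans (ler_enorm_dist (word_map f t x0) _ _)).
    by rewrite (word_map_dist simf) /K2 mulrDl [leRHS]addrC (mulrC _ (enorm _)) lerD2l.
  move=> /(le_trans (abs_coord_le_enorm _ i)).
  rewrite -ler_pdivrMr // -[wprod ratio t in X in X -> _](gtr0_norm r0) -normf_div.
  rewrite ler_norml => /andP[h1 h2].
  have p0 : 0 <= ((word_map f t z0 - y) ord0 i / wprod ratio t + K2) * L.
    by apply: mulr_ge0; [lra|exact: ltW].
  split=> //; rewrite ltnS; apply: le_truncn; apply: ler_wpM2r; [exact: ltW|lra].
have hinj : {in A &, injective h}.
  move=> t t' tA t'A [/ffunP hc /ffunP hg].
  have cnt i : count_mem i t = count_mem i t'.
    have := congr1 val (hc i); rewrite !ffunE /= !inordK // ltnS.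
      by rewrite -[k in (_ <= k)%N](size_tuple t') count_size.
    by rewrite -[k in (_ <= k)%N](size_tuple t) count_size.
  have tt' : perm_eq t t' by apply/allP => i _ /=; apply/eqP; exact: cnt.
  have rr : wprod ratio t = wprod ratio t' by apply: perm_big.
  have r0 := wratio_gt0 simf t; set rho := wprod ratio t in rr r0.
  (* [n] coordinates differing by at most [rho / L = delta * rho / (n + 1)] *)
  have close : enorm (word_map f t' z0 - word_map f t z0) < delta * rho.
    apply: (le_lt_trans (enorm_le_sum _)).
    apply: (@le_lt_trans _ _ (\sum_(i < n) rho / L)).
      apply: ler_sum => i _.
      have := congr1 val (hg i); rewrite !ffunE /= !inordK ?(cellP _ _ _).2 //.
      have [/truncn_itv] := cellP t i tA; rewrite -/(cell t i) => /andP[a1 a2] _.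
      have [/truncn_itv] := cellP t' i t'A; rewrite -/(cell t' i) => /andP[b1 b2] _.
      move=> e; move: a1 a2 b1 b2; rewrite -rr -/rho -e.
      set a := (_ - y) ord0 i / rho; set b := (_ - y) ord0 i / rho => a1 a2 b1 b2.
      have -> : (word_map f t' z0 - word_map f t z0) ord0 i = (b - a) * rho.
        rewrite mulrBl !divfK ?gt_eqF // !mxE; ring.
      rewrite normrM (gtr0_norm r0) mulrC ler_pM2l //.
      rewrite -[leRHS]mul1r ler_pdivlMr // -{1}(gtr0_norm L0) -normrM.
      by rewrite ler_norml; move: a2 b2; rewrite -natr1; nra.
    rewrite sumr_const card_ord -mulr_natl.
    have n1 : 0 < n%:R + 1 :> R by rewrite ltr_wpDl.
    have -> : n%:R * (rho / L) = delta * rho * (n%:R / (n%:R + 1)).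
      by rewrite /L; field; rewrite !gt_eqF.
    by rewrite gtr_pMr ?mulr_gt0 // ltr_pdivrMr // mul1r ltrDl.
  have [c hc'] := word_map_onto simf t (word_map f t' z0).
  have Uc : U c.
    apply: dU; rewrite -ball_normE /ball_ /=; apply: (le_lt_trans (norm_le_enorm _)).
    rewrite enormB -(ltr_pM2l r0) -(word_map_dist simf) hc' mulrC; exact: close.
  apply/val_inj; apply: (word_images_disjoint fU tU _ Uc Uz0 hc').
  by rewrite !size_tuple.
rewrite -(card_in_imset hinj); apply: (leq_trans (max_card _)).
by rewrite card_prod !card_ffun !card_ord.
Qed.

End Overlap.

(** * Typical codes *)

(** The partial sums telescope: [1 / t ^ 2 <= 2 / t - 2 / (t + 1)] for [t >= 1]. *)
Lemma nneseries_inv_square_lty (R : realType) (u : nat -> \bar R) (c : R) :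
  0 <= c -> (forall k, 0 <= u k)%E -> (forall k, u k <= (c / k.+1%:R ^+ 2)%:E)%E ->
  (\sum_(0 <= k <oo) u k < +oo)%E.
Proof.
move=> c0 u0 hu; apply: (@le_lt_trans _ _ (2 * c)%:E); last exact: ltry.
apply: lime_le; first exact: is_cvg_nneseries.
apply: nearW => l; apply: (@le_trans _ _ (\sum_(0 <= k < l) (c / k.+1%:R ^+ 2)%:E)%E).
  by apply: lee_sum => k _.
rewrite sumEFin lee_fin.
suff : \sum_(0 <= k < l) c / k.+1%:R ^+ 2 <= 2 * c - 2 * c / l.+1%:R.
  by move=> /le_trans; apply; rewrite gerBl divr_ge0 // mulr_ge0.
elim: l => [|l IH]; first by rewrite big_geq // divr1 subrr.
rewrite big_nat_recr //=; apply: (le_trans (lerD IH (lexx _))).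
have l0 : 0 < l.+1%:R :> R by [].
rewrite -[l.+2%:R]natr1; set t : R := l.+1%:R in l0 *.
have t1 : 1 <= t by rewrite /t ler1n.
have -> : 2 * c - 2 * c / (t + 1) =
    2 * c - 2 * c / t + c / t ^+ 2 + c * (t - 1) / (t ^+ 2 * (t + 1)).
  by field; rewrite !gt_eqF //; lra.
rewrite lerDl divr_ge0 //; first by rewrite mulr_ge0 // subr_ge0.
by rewrite mulr_ge0 ?exprn_ge0 // ltW //; lra.
Qed.

Section Estimates.
Context {R : realType} {n N : nat}.
Variables (ratio : 'I_N.+1 -> R) (f : 'I_N.+1 -> 'rV[R]_n -> 'rV[R]_n).
Variables (E : set 'rV[R]_n) (p : 'I_N.+1 -> R).
Variable mu : {measure set borelRn R n -> \bar R}.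
Variable nu : {measure set code_space N -> \bar R}.
Hypothesis simf : contracting_similitudes ratio f.
Hypothesis selfE : self_similar_set f E.
Hypothesis oscf : open_set_condition f.
Hypothesis probp : probability_vector p.
Hypothesis bernu : bernoulli_measure p nu.
Hypothesis hmu : forall A : set (borelRn R n), measurable A ->
  mu A = pushforward nu (natural_projection f E : code_space N -> borelRn R n) A.

Definition word_ball x0 K u : set 'rV[R]_n :=
  closed_eball (word_map f u x0) (K * wprod ratio u).

Definition light_word x0 K (eps : R) : pred (seq 'I_N.+1) :=
  fun u => wprod p u < eps * fine (mu (word_ball x0 K u)).

Lemma word_ball_measurable x0 K u : measurable (word_ball x0 K u : set (borelRn R n)).
Proof. by apply: closed_borel; exact: closed_eball_closed. Qed.

(** The measures of the balls at level [k] add up to at most their overlap,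
which grows polynomially in [k], so a word rarely carries a much smaller mass
than the ball around its image. *)
Lemma nu_light_word x0 K : 0 < K -> exists c : nat, forall k eps, 0 <= eps ->
  (nu (word_event k (light_word x0 K eps)) <= (eps * (k.+1 ^ N.+1 * c)%N%:R)%:E)%E.
Proof.
move=> K0; have [c hc] := overlap_card simf oscf x0 K0.
exists c => k eps eps0; rewrite (nu_word_event bernu) lee_fin.
pose B (t : k.-tuple 'I_N.+1) : set (borelRn R n) := word_ball x0 K t.
have mB t : measurable (B t : set (borelRn R n)) by exact: word_ball_measurable.
have fB t : mu (B t) \is a fin_num by apply: (mu_fin bernu hmu).
apply: (@le_trans _ _ (eps * \sum_t fine (mu (B t)))).
  rewrite mulr_sumr [leRHS](bigID (fun t : k.-tuple _ => light_word x0 K eps t)) /=.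
  apply: ler_wpDr; last by apply: ler_sum => t /ltW.
  by apply: sumr_ge0 => t _; rewrite mulr_ge0 // fine_ge0.
rewrite ler_wpM2l // -lee_fin -sumEFin.
under eq_bigr => t _ do rewrite fineK // -[B t]setIT -integral_indic //.
have mI t : measurable_fun setT (EFin \o (\1_(B t) : borelRn R n -> R)).
  by apply/measurable_EFinP; exact: measurable_indic.
have I0 t (x : borelRn R n) : setT x -> (0 <= (EFin \o (\1_(B t) : borelRn R n -> R)) x)%E.
  by move=> _; rewrite lee_fin.
rewrite -(ge0_integral_sum _ measurableT mI I0).
apply: (@le_trans _ _ (\int[mu]_(x in setT) cst (k.+1 ^ N.+1 * c)%N%:R%:E x)%E).
  apply: ge0_le_integral => //=.
  - by move=> x _; apply: sume_ge0 => t _; rewrite lee_fin.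
  - exact: emeasurable_sum.
  - move=> x _; rewrite sumEFin lee_fin.
    under eq_bigr => t _ do rewrite indicE.
    rewrite -natr_sum ler_nat; apply: leq_trans (hc k x).
    rewrite -sum1_card big_mkcond /= leq_eqVlt; apply/orP; left; apply/eqP.
    rewrite [RHS]big_mkcond /=; apply: eq_bigr => t _.
    rewrite inE; case: ifPn => h; case: (boolP (x \in B t)) => //=.
      by rewrite notin_setE /B /word_ball /closed_eball /= enormB.
    by rewrite in_setE /B /word_ball /closed_eball /= enormB => h'; rewrite h' in h.
by rewrite integral_cst //= (mu_setT bernu hmu) mule1.
Qed.

End Estimates.

(** A number of independent trials proportional to [log (k + 1)] makes the
probability that all of them fail summable in [k], ... *)
Lemma exp_trunc_log_le (R : realType) (q : R) T k : 0 <= q -> q ^+ T <= 4^-1 ->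
  q ^+ (T * trunc_log 2 k.+1) <= 4 / k.+1%:R ^+ 2.
Proof.
move=> q0 qT; rewrite exprM.
have /andP[_] := trunc_log_bounds (ltnSn 1) (ltn0Sn k).
set t := trunc_log 2 k.+1 => kt.
have k0 : 0 < k.+1%:R ^+ 2 :> R by rewrite exprn_gt0.
apply: (@le_trans _ _ (4^-1 ^+ t)); first by rewrite lerXn2r ?nnegrE ?exprn_ge0 ?invr_ge0.
rewrite exprVn ler_pdivlMr // mulrC ler_pdivrMr ?exprn_gt0 //.
have -> : 4 * 4 ^+ t = (2 ^ t.+1)%N%:R ^+ 2 :> R.
  by rewrite -exprS natrX -exprM mulnC exprM; congr (_ ^+ _); rewrite -natrX.
by rewrite lerXn2r ?nnegrE // ler_nat ltnW.
Qed.

(** ... while prescribing that many letters costs only a power of [k + 1]. *)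
Lemma exp_trunc_log_ge (R : realType) (a : R) T A k : 0 <= a -> 2^-1 ^+ A <= a ^+ T ->
  k.+1%:R^-1 ^+ A <= a ^+ (T * trunc_log 2 k.+1).
Proof.
move=> a0 aT; rewrite exprM.
have /andP[kt _] := trunc_log_bounds (ltnSn 1) (ltn0Sn k).
set t := trunc_log 2 k.+1 in kt *.
apply: (@le_trans _ _ ((2^-1 ^+ A) ^+ t)); last first.
  by rewrite lerXn2r ?nnegrE ?exprn_ge0 ?invr_ge0.
rewrite -exprM mulnC exprM lerXn2r ?nnegrE ?exprn_ge0 ?invr_ge0 //.
by rewrite exprVn lef_pV2 ?posrE ?exprn_gt0 // -natrX ler_nat.
Qed.

Section TypicalCodes.
Context {R : realType} {n N : nat}.
Variables (ratio : 'I_N.+1 -> R) (f : 'I_N.+1 -> 'rV[R]_n -> 'rV[R]_n).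
Variables (E : set 'rV[R]_n) (p : 'I_N.+1 -> R).
Variable mu : {measure set borelRn R n -> \bar R}.
Variable nu : {measure set code_space N -> \bar R}.
Hypothesis simf : contracting_similitudes ratio f.
Hypothesis selfE : self_similar_set f E.
Hypothesis oscf : open_set_condition f.
Hypothesis probp : probability_vector p.
Hypothesis bernu : bernoulli_measure p nu.
Hypothesis hmu : forall A : set (borelRn R n), measurable A ->
  mu A = pushforward nu (natural_projection f E : code_space N -> borelRn R n) A.

(** The number of blocks in which the universal word is looked for after the
[k]-th letter. *)
Definition window T k := (T * trunc_log 2 k.+1)%N.

(** The power [N.+1] compensates the number of letter counts of words of length
[k] on [N.+1] letters, and two more powers make the series converge. *)
Definition eps_level k : R := k.+1%:R^-1 ^+ N.+3.

(** A condition on the prefix [s] of length [k + window T k * size u] of a code. *)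
Definition typical_word u (x0 : 'rV[R]_n) (K : R) T k : pred (seq 'I_N.+1) := fun s =>
  [&& positive_word p s, has_block u k (window T k) s
    & ~~ light_word ratio f p mu x0 K (eps_level k) (take k s)].

(** Each of the events that make a prefix atypical has a probability of order
[1 / k ^ 2] at most, so the Borel-Cantelli lemma applies. *)
Lemma ae_typical_codes u x0 K : positive_word p u -> 0 < K ->
  exists T (Z : set (borelRn R n)), [/\ measurable Z, mu Z = 0%E &
    forall x, ~ Z x -> exists w j, codes f E w x /\ forall k, (j <= k)%N ->
      typical_word u x0 K T k (mkseq w (k + window T k * size u))].
Proof.
move=> pu K0; have [c hc] := nu_light_word simf oscf bernu hmu x0 K0.
have q0 : 0 <= 1 - wprod p u by rewrite subr_ge0 (wprod_prob_le1 probp).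
have q1 : 1 - wprod p u < 1 by rewrite ltrBlDr ltrDl wprod_gt0.
have i4 : 0 < 4^-1 :> R by rewrite invr_gt0.
have [|T hT] := @geometric_small R (1 - wprod p u) 1 4^-1 _ i4; first by rewrite q0.
rewrite mul1r in hT.
exists T; apply: (ae_codes simf selfE bernu hmu (len := fun k => (k + window T k * size u)%N)).
apply: (@nneseries_inv_square_lty _ _ (4 + c%:R)) => // k.
set l := (k + _)%N.
pose A1 : set (code_space N) := word_event l (predC (positive_word p)).
pose A2 : set (code_space N) := word_event l (fun s => ~~ has_block u k (window T k) s).
pose A3 : set (code_space N) := word_event k (light_word ratio f p mu x0 K (eps_level k)).
have mA1 : measurable A1 by exact: (word_event_measurable bernu).
have mA2 : measurable A2 by exact: (word_event_measurable bernu).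
have mA3 : measurable A3 by exact: (word_event_measurable bernu).
have sub : word_event l (predC (typical_word u x0 K T k)) `<=` A1 `|` (A2 `|` A3).
  move=> w; rewrite /word_event /= !negb_and negbK take_mkseq ?leq_addr //.
  by case/or3P => h; [left|right; left|right; right].
have n1 : nu A1 = 0%E := nu_nonpositive_word probp bernu l.
have n2 : (nu A2 <= (4 / k.+1%:R ^+ 2)%:E)%E.
  by rewrite (nu_miss_block bernu) lee_fin; exact: exp_trunc_log_le.
have n3 : (nu A3 <= (c%:R / k.+1%:R ^+ 2)%:E)%E.
  have e0 : 0 <= eps_level k by rewrite exprn_ge0.
  apply: (le_trans (hc k _ e0)); rewrite lee_fin natrM natrX /eps_level -[N.+3](addn2 N.+1).
  rewrite (exprD _ N.+1 2) mulrACA -exprMn.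
  by rewrite mulVf // expr1n mul1r exprVn mulrC.
apply: (@le_trans _ _ (nu (A1 `|` (A2 `|` A3)))%E).
  apply: le_measure; rewrite ?inE //; first exact: (word_event_measurable bernu).
  by apply: measurableU => //; apply: measurableU.
apply: (le_trans (measureU2 nu mA1 (measurableU _ _ mA2 mA3))).
rewrite mulrDl EFinD -[leRHS]add0e -n1; apply: leeD => //.
by apply: (le_trans (measureU2 nu mA2 mA3)); apply: leeD.
Qed.

End TypicalCodes.

(** * The mass of the cones *)

Section ConeMass.
Context {R : realType} {n m N : nat}.
Variables (ratio : 'I_N.+1 -> R) (f : 'I_N.+1 -> 'rV[R]_n -> 'rV[R]_n).
Variables (E : set 'rV[R]_n) (p : 'I_N.+1 -> R).
Variable mu : {measure set borelRn R n -> \bar R}.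
Variable nu : {measure set code_space N -> \bar R}.
Hypothesis simf : contracting_similitudes ratio f.
Hypothesis selfE : self_similar_set f E.
Hypothesis bernu : bernoulli_measure p nu.
Hypothesis hmu : forall A : set (borelRn R n), measurable A ->
  mu A = pushforward nu (natural_projection f E : code_space N -> borelRn R n) A.
Hypothesis mn : (m < n)%N.

(** [u] is a universal word for [alpha / 2], and [a] a lower bound of the positive
weights. *)
Variables (D rmin : R) (x0 : 'rV[R]_n).
Hypothesis D0 : 0 < D.
Hypothesis diamE : forall x y, E x -> E y -> enorm (x - y) <= D.
Hypothesis rmin0 : 0 < rmin.
Hypothesis Ex0 : E x0.

Variables (u : seq 'I_N.+1) (c alpha : R).
Hypothesis alpha0 : 0 < alpha.
Hypothesis c0 : 0 < c.
Hypothesis univ : forall (M : 'M[R]_(n, m)) (theta : 'rV[R]_n),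
  (forall z, enorm (z *m M) <= enorm z) -> enorm theta <= 1 ->
  exists v, [/\ positive_word p v, c <= wprod p v & forall x y,
    wimage f E u x -> wimage f E v y -> cone_pair M theta (alpha / 2) x y].

Variables (a : R) (A T : nat).
Hypothesis a01 : 0 < a <= 1.
Hypothesis pa : forall i, 0 < p i -> a <= p i.
Hypothesis aT : 2^-1 ^+ A <= (a ^+ size u) ^+ T.

(** At the level [k] the image of [E] under the prefix of the code of [x] has
size comparable to [r]. *)
Variables (w : nat -> 'I_N.+1) (x : 'rV[R]_n) (k : nat) (r : R).
Hypothesis wx : codes f E w x.
Hypothesis typ : typical_word ratio f p mu u x0 (D / rmin + D) T k
  (mkseq w (k + window T k * size u)).
Hypothesis r_ge : D * wprod ratio (mkseq w k) <= r.
Hypothesis r_le : r <= D / rmin * wprod ratio (mkseq w k).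

Lemma ball_measurable : measurable (closed_eball x r : set (borelRn R n)).
Proof. by apply: closed_borel; exact: closed_eball_closed. Qed.

Lemma positive_prefix j : (j <= k + window T k * size u)%N -> positive_word p (mkseq w j).
Proof.
move=> jl; have /and3P[pw _ _] := typ.
by move: pw; rewrite -(subnKC jl) mkseqD /positive_word all_cat => /andP[].
Qed.

Lemma ball_contains_wimage : wimage f E (mkseq w k) `<=` closed_eball x r.
Proof. by move=> y yw; apply: le_trans r_ge; apply: (wimage_dist simf diamE yw). Qed.

Lemma ball_mass_gt0 : 0 < fine (mu (closed_eball x r)).
Proof.
have pk : 0 < wprod p (mkseq w k) by apply: wprod_gt0; apply: positive_prefix; exact: leq_addr.
apply: lt_le_trans pk _; rewrite -lee_fin fineK; last exact: (mu_fin bernu hmu ball_measurable).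
exact: (mu_ge_wimage simf selfE bernu hmu ball_measurable ball_contains_wimage).
Qed.

(** The ball around [x] is contained in the ball by which a light word is
defined. *)
Lemma ball_mass_le : @eps_level R N k * fine (mu (closed_eball x r)) <= wprod p (mkseq w k).
Proof.
have /and3P[_ _] := typ; rewrite take_mkseq ?leq_addr // /light_word -leNgt.
apply: le_trans; rewrite ler_wpM2l ?exprn_ge0 //.
apply: fine_le; [exact: (mu_fin bernu hmu ball_measurable)| |].
  by apply: (mu_fin bernu hmu); exact: word_ball_measurable.
apply: le_measure; rewrite ?inE; [exact: ball_measurable|exact: word_ball_measurable|].
move=> y yx; apply: (le_trans (ler_enorm_dist x _ _)); rewrite mulrDl.
apply: lerD; first exact: le_trans yx r_le.
by apply: (wimage_dist simf diamE (wx k)); exists x0.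
Qed.

(** Let the universal word occur right after the prefix [g] of the code of [x].
The cones based at [x], seen through the word map of [g], become cones based at a
point of the image under the universal word, which contain the image of [E] under
some word [v]. So the cones at [x] contain the image under [g ++ v], whose mass is
that of the level [k] prefix up to the letters between level [k] and the
occurrence, and up to [v]. *)
Lemma cone_mass theta (V : {vspace 'rV[R]_n}) :
  unit_sphere theta -> grassmannian (n - m) V ->
  ((c * k.+1%:R^-1 ^+ (A + N.+3) * fine (mu (closed_eball x r)))%:E <=
   mu ((closed_eball x r `&` coneX x V alpha) `\` coneH x theta alpha))%E.
Proof.
move=> th dV.
have [M [M1 MV]] := edist_frame (ltnW mn) dV.
have /and3P[_ /has_blockP[i ib wi] _] := typ.
set k' := (k + i * size u)%N in wi.
have k'l : (k' + size u <= k + window T k * size u)%N.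
  by rewrite /k' -addnA leq_add2l addnC -mulSn leq_mul2r ib orbT.
have k'l' : (k' <= k + window T k * size u)%N by apply: leq_trans k'l; exact: leq_addr.
have [M' [theta' [pull [M'1 t'1]]]] := cone_pair_word_map simf (mkseq w k') M theta.
have [|v [pv cv hv]] := univ (M'1 M1) (theta := theta'); first by rewrite t'1 th.
have [x' Ex' x'x] := wx (k' + size u); rewrite wi word_map_cat in x'x.
have mS : measurable
    ((closed_eball x r `&` coneX x V alpha) `\` coneH x theta alpha : set (borelRn R n)).
  apply: measurableD; last by apply: open_borel; exact: coneH_open.
  by apply: measurableI; [exact: ball_measurable|apply: open_borel; exact: coneX_open].
have sub : wimage f E (mkseq w k' ++ v) `<=`
    (closed_eball x r `&` coneX x V alpha) `\` coneH x theta alpha.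
  move=> y yw; have yk : wimage f E (mkseq w k) y.
    by apply: (wimage_mkseq_sub selfE (leq_addr (i * size u) k)); apply: wimage_sub yw.
  case: (yw) => y' Ey' y'y; rewrite word_map_cat in y'y.
  have : cone_pair M theta (alpha / 2) x y.
    by rewrite -x'x -y'y; apply/pull; apply: hv; [exists x'|exists y'].
  move=> [yx yM yt]; have z0 : 0 < enorm (y - x) by rewrite enorm_gt0 subr_eq0.
  have az : 0 < alpha * enorm (y - x) by rewrite mulr_gt0.
  have half : alpha / 2 * enorm (y - x) = (alpha * enorm (y - x)) / 2 by field.
  rewrite half in yM yt.
  split; first split; first exact: ball_contains_wimage.
    rewrite /coneX /=; apply: le_lt_trans (MV _) _; apply: le_lt_trans yM _.
    by rewrite ltr_pdivrMr // ltr_pMr // ltr1n.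
  rewrite /coneH /=; apply/negP; rewrite -leNgt; apply: le_trans yt _.
  by rewrite ler_pdivrMr // ler_pMr // ler1n.
apply: le_trans (mu_ge_wimage simf selfE bernu hmu mS sub).
rewrite lee_fin wprod_cat /k' mkseqD wprod_cat.
set mid := mkseq (fun j => w (k + j)%N) _; have pmid : positive_word p mid.
  by have := positive_prefix k'l'; rewrite /k' mkseqD /positive_word all_cat => /andP[].
have /andP[a0 a1] := a01.
have hmid : k.+1%:R^-1 ^+ A <= wprod p mid.
  apply: le_trans (exp_trunc_log_ge k (exprn_ge0 _ (ltW a0)) aT) _.
  apply: (@le_trans _ _ (a ^+ size mid)).
    rewrite /mid size_mkseq -exprM; apply: ler_wiXn2l; rewrite ?(ltW a0) //.
    by rewrite mulnC leq_mul2l ltnW ?orbT.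
  by apply: (wprod_ge_exp (P := fun i => 0 < p i)) => //; exact: ltW.
have hk := ball_mass_le; rewrite /eps_level in hk.
rewrite exprD.
have -> : c * (k.+1%:R^-1 ^+ A * k.+1%:R^-1 ^+ N.+3) * fine (mu (closed_eball x r)) =
  (k.+1%:R^-1 ^+ N.+3 * fine (mu (closed_eball x r))) * k.+1%:R^-1 ^+ A * c by ring.
have f0 := ltW ball_mass_gt0.
have e0 j : 0 <= k.+1%:R^-1 ^+ j :> R by rewrite exprn_ge0.
have ef0 : 0 <= k.+1%:R^-1 ^+ N.+3 * fine (mu (closed_eball x r)) by exact: mulr_ge0.
apply: ler_pM cv; [exact: mulr_ge0|exact: ltW|].
exact: ler_pM.
Qed.

End ConeMass.

(** * From levels to radii *)

Lemma level_le_log (R : realType) (D q r : R) k : 0 < D -> 0 < q < 1 -> 0 < r ->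
  1 <= `|ln r| -> r <= D * q ^+ k ->
  k.+2%:R <= ((`|ln D| + 1) / (- ln q) + 2) * `|ln r|.
Proof.
move=> D0 /andP[q0 q1] r0 L1 hr.
have lq : 0 < - ln q by rewrite oppr_gt0 ln_lt0 // q0.
have : ln r <= ln D + k%:R * ln q.
  by rewrite mulr_natl -lnXn // -lnM ?posrE ?exprn_gt0 // ler_ln ?posrE ?mulr_gt0 ?exprn_gt0.
move=> h; have h1 : k%:R * (- ln q) <= (`|ln D| + 1) * `|ln r|.
  have := ler_norm (ln D); have := ler_norm (- ln r); rewrite normrN => h2 h3.
  have : `|ln D| * 1 <= `|ln D| * `|ln r| by rewrite ler_wpM2l.
  by rewrite mulr1 mulrDl mul1r; lra.
rewrite mulrDl -addn2 natrD; apply: lerD; last by rewrite ler_pMr.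
by rewrite mulrAC ler_pdivlMr.
Qed.

Lemma power_log_le (R : realType) (L C c : R) A k : 1 <= L -> 0 < C -> 0 < c ->
  k.+1%:R <= C * L -> C ^+ A / c <= L ->
  L `^ (- A.+1%:R) <= c * k.+1%:R^-1 ^+ A.
Proof.
move=> L1 C0 c0 kL hL; have L0 : 0 < L by apply: lt_le_trans L1.
rewrite powRN powR_mulrn; last exact: ltW.
apply: (@le_trans _ _ (c * (C * L)^-1 ^+ A)); last first.
  have CL0 : 0 < C * L by rewrite mulr_gt0.
  rewrite ler_pM2l // lerXn2r ?nnegrE ?invr_ge0 ?(ltW CL0) //.
  by rewrite lef_pV2 ?posrE.
have CL : 0 < C ^+ A * L ^+ A by rewrite mulr_gt0 // exprn_gt0.
rewrite exprVn exprMn ler_pdivlMr // exprS invfM mulrACA mulVf ?gt_eqF ?exprn_gt0 //.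
by rewrite mulr1 mulrC ler_pdivrMr // -ler_pdivrMl // mulrC.
Qed.

Lemma le_limf_einf_at_right (R : realType) (g : R -> \bar R) (b r0 : R) : 0 < r0 ->
  (forall r, 0 < r < r0 -> (b%:E <= g r)%E) -> (b%:E <= limf_einf g 0^'+)%E.
Proof.
move=> r00 hg; rewrite /limf_einf leeNr; apply: ereal_inf_le => /=.
pose V := [set r : R | 0 < r < r0].
exists (ereal_sup ((\- g)%E @` V)).
  exists V => //.
  near=> r => /=; apply/andP; split; first by near: r; exact: nbhs_right_gt.
  by near: r; exact: nbhs_right_lt.
by apply: ge_ereal_sup => _ [r rr <-] /=; rewrite EFinN leeN2 hg.
Unshelve. all: by end_near. Qed.

Theorem theorem4p1 (R : realType) (n m k : nat)
    (ratio : 'I_k.+2 -> R) (f : 'I_k.+2 -> 'rV[R]_n -> 'rV[R]_n)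
    (E : set 'rV[R]_n) (p : 'I_k.+2 -> R)
    (mu : {measure set borelRn R n -> \bar R}) (alpha : R) :
  (m < n)%N ->
  contracting_similitudes ratio f ->
  self_similar_set f E ->
  open_set_condition f ->
  probability_vector p ->
  self_similar_measure f E p mu ->
  purely_unrectifiable m mu ->
  0 < alpha <= 1 ->
  exists s : R, 1 < s /\
    {ae mu, forall x : 'rV[R]_n,
      (1 <= limf_einf (fun r : R =>
              ereal_inf [set cone_ratio mu alpha s x r theta V
                        | theta in unit_sphere & V in grassmannian (n - m)])
            0^'+)%E}.
Proof.
move=> mn simf selfE oscf probp [nu [bernu hmu]] unr /andP[alpha0 _].
have flat := flat_pairs_of_unrectifiable simf selfE probp bernu hmu unr.
have alpha20 : 0 < alpha / 2 by rewrite divr_gt0.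
have [u [c [pu c0 univ]]] := universal_word simf selfE flat alpha20.
have [D D0 diamE] := self_similar_bounded selfE.
have [rmin [rmax [rmin0 /andP[rmax0 rmax1] rb]]] := ratio_bounds simf.
have [[x0 Ex0] _ _] := selfE.
have [a a01 pa] : exists2 a : R, 0 < a <= 1 & forall i, 0 < p i -> a <= p i.
  have [i hi] := exists_minorant (fun i => if 0 < p i then p i else 1).
  exists (Num.min (if 0 < p i then p i else 1) 1); last first.
    by move=> j pj; rewrite ge_min; have := hi j; rewrite pj => ->.
  by rewrite ge_min lexx orbT andbT lt_min ltr01 andbT; case: ifP.
have K0 : 0 < D / rmin + D by rewrite addr_gt0 // divr_gt0.
have [T [Z [mZ Z0 hZ]]] := ae_typical_codes simf selfE oscf probp bernu hmu x0 pu K0.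
have aT0 : 0 < (a ^+ size u) ^+ T by have /andP[a0 _] := a01; rewrite !exprn_gt0.
have h01 : 0 <= (2^-1 : R) < 1 by apply/andP; split; lra.
have [A hA] := @geometric_small R _ 1 _ h01 aT0; rewrite mul1r in hA.
pose A' := (A + k.+4)%N.
(* [A] powers are lost by the letters before the universal word, [k.+4] by the
   comparison of a word with a ball, and one more absorbs the constants. *)
exists A'.+1%:R; split; first by rewrite ltr1n ltnS /A' addnS.
exists Z; split=> // x /= xP; apply: contrapT => /hZ[w [j [wx typ]]]; apply: xP.
pose C := (`|ln D| + 1) / (- ln rmax) + 2.
have lq : 0 < - ln rmax by rewrite oppr_gt0 ln_lt0 // rmax0.
have C0 : 0 < C by rewrite ltr_wpDl // divr_ge0 ?addr_ge0 // ltW.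
have cA0 : 0 <= C ^+ A' / c by rewrite divr_ge0 ?exprn_ge0 // ltW.
pose L0 : R := 1 + C ^+ A' / c.
have wr0 i : 0 < wprod ratio (mkseq w i) := wratio_gt0 simf _.
pose r0 := Num.min (expR (- L0)) (D * wprod ratio (mkseq w j)).
have r00 : 0 < r0 by rewrite lt_min expR_gt0 mulr_gt0.
apply: (le_limf_einf_at_right r00) => r /andP[rgt0]; rewrite lt_min => /andP[rL rj].
have lnr : L0 <= `|ln r|.
  have : ln r <= - L0 by rewrite -[leRHS]expRK ler_ln ?posrE ?expR_gt0 // ltW.
  by rewrite lerNr => /le_trans; apply; rewrite -normrN ler_norm.
have ub i : wprod ratio (mkseq w i) <= rmax ^+ i.
  rewrite -[i in leRHS](size_mkseq w); apply: wprod_le_exp => l.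
  by have /andP[_ ->] := rb l; rewrite ltW // (ratio_gt0 simf).
have stop : exists i, D * wprod ratio (mkseq w i) <= r.
  have r01 : 0 <= rmax < 1 by rewrite ltW.
  have [i hi] := @geometric_small R _ D _ r01 rgt0; exists i.
  by apply: le_trans hi; apply: ler_wpM2l (ub i); exact: ltW.
(* the first level at which the image of [E] has diameter at most [r] *)
case: (ex_minnP stop) => l rl lmin.
have dec i : wprod ratio (mkseq w i.+1) = wprod ratio (mkseq w i) * ratio (w i).
  by rewrite mkseqS -cats1 wprod_cat /wprod big_seq1.
have mono i i' : (i <= i')%N -> wprod ratio (mkseq w i') <= wprod ratio (mkseq w i).
  move=> /subnKC <-; elim: (i' - i)%N => [|d IH]; first by rewrite addn0.
  rewrite addnS dec; apply: le_trans IH; rewrite ler_piMr ?ltW //.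
  by have /andP[_ /le_lt_trans->] := rb (w (i + d)%N).
have jl : (j < l)%N.
  rewrite ltnNge; apply/negP => lj; have := lt_le_trans rj (ler_wpM2l (ltW D0) (mono _ _ lj)).
  by rewrite ltNge rl.
case: l jl rl lmin => // l; rewrite ltnS => jl rl lmin.
have rlt : r < D * wprod ratio (mkseq w l).
  by rewrite ltNge; apply/negP => /lmin; rewrite ltnn.
have rle : r <= D / rmin * wprod ratio (mkseq w l.+1).
  apply: (le_trans (ltW rlt)); rewrite dec -mulrA ler_pM2l // mulrCA.
  rewrite ler_pMr //.
  by have /andP[rm _] := rb (w l); rewrite mulrC ler_pdivlMr // mul1r.
have typl := typ l.+1 (leqW jl).
have b0 := ball_mass_gt0 simf selfE bernu hmu diamE wx typl rl.
have mB := @ball_measurable R n x r.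
have fB := mu_fin bernu hmu mB.
set b := fine _ in b0.
have muB : mu (closed_eball x r) = b%:E by rewrite fineK.
have L1 : 1 <= `|ln r| by apply: le_trans lnr; rewrite lerDl.
have CL : l.+2%:R <= C * `|ln r|.
  apply: level_le_log => //; first by rewrite rmax0.
  by apply: (le_trans (ltW rlt)); rewrite ler_pM2l.
have pow : `|ln r| `^ (- A'.+1%:R) <= c * l.+2%:R^-1 ^+ A'.
  by apply: (power_log_le L1 C0 c0 CL); apply: le_trans lnr; rewrite lerDr.
have pow0 : 0 < `|ln r| `^ (- A'.+1%:R) by rewrite powR_gt0 // (lt_le_trans _ L1).
apply: le_ereal_inf_tmp => _ [theta th [V dV <-]].
have mass := cone_mass simf selfE bernu hmu mn diamE Ex0 alpha0 c0 univ a01 pa hA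
  wx typl rl rle th dV.
rewrite /cone_ratio muB -EFinM inver gt_eqF ?mulr_gt0 //.
set S := mu _ in mass *.
set d := `|ln r| `^ (- A'.+1%:R) * b.
rewrite -[1%E](_ : (d%:E * (d^-1)%:E)%E = 1%E); last first.
  by rewrite -EFinM mulfV // gt_eqF // mulr_gt0.
apply: lee_wpmul2r; first by rewrite lee_fin invr_ge0 ltW // mulr_gt0.
by apply: le_trans mass; rewrite lee_fin ler_pM2r.
Qed.
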